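(* Let $X$ be a metric space. Suppose that measures $\mu_n\in\mathcal{P}_r(X)$, $n\ge1$, converge to a measure $\mu_0\in\mathcal{P}_r(X)$ in variation, measures $\nu_n\in\mathcal{P}_r(X)$, $n\ge1$, converge weakly to a measure $\nu_0\in\mathcal{P}_r(X)$, both sequences $\{\mu_n\}$ and $\{\nu_n\}$ are uniformly tight, and continuous functions $h_n\colon X\times X\to[0,+\infty)$, $n\ge1$, converge to a function $h_0\colon X\times X\to[0,+\infty)$ uniformly on compact sets. Suppose also that there are nonnegative Borel functions $a_n\in L^1(\mu_n)$ and $b_n\in L^1(\nu_n)$, $n\ge1$, such that $$h_n(x,y)\le a_n(x)+b_n(y),\qquad \lim_{R\to+\infty}\sup_n\Bigl(\int_{\{a_n\ge R\}}a_n\,d\mu_n+\int_{\{b_n\ge R\}}b_n\,d\nu_n\Bigr)=0.$$ Suppose that for every $n\ge0$ the optimal plan $\sigma_n$ for the triple $(\mu_n,\nu_n,h_n)$ is unique and is generated by a unique Monge optimal mapping $T_n$. Then the mappings $T_n$ converge to $T_0$ in measure $\mu_0$.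
   Context: $\mathcal{P}_r(X)$ is the set of Radon probability measures on $X$: Borel probability measures $\mu$ such that for every Borel set $B$ and $\varepsilon>0$ there is a compact set $K\subset B$ with $\mu(B\setminus K)<\varepsilon$. Weak convergence means convergence of integrals of all bounded continuous functions; convergence in variation is convergence in the total variation norm. A set $\mathcal{M}$ of measures is uniformly tight if for every $\varepsilon>0$ there is a compact set $K\subset X$ with $\mu(X\setminus K)<\varepsilon$ for all $\mu\in\mathcal{M}$. $\Pi(\mu,\nu)$ is the set of Borel probability measures on $X\times X$ with marginals $\mu$ and $\nu$; $K_h(\mu,\nu)=\inf_{\sigma\in\Pi(\mu,\nu)}\int h\,d\sigma$; an optimal plan for $(\mu,\nu,h)$ is a measure $\sigma\in\Pi(\mu,\nu)$ with $\int h\,d\sigma=K_h(\mu,\nu)$. A Monge optimal mapping for $(\mu,\nu,h)$ is a Borel mapping $T\colon X\to X$ with $\mu\circ T^{-1}=\nu$ that minimizes $\int h(x,T(x))\,\mu(dx)$ among all such mappings; uniqueness is understood up to equality $\mu$-almost everywhere. The plan generated by $T$ is the image of $\mu$ under the mapping $x\mapsto(x,T(x))$. Convergence in measure of $T_n$ to $T_0$ with respect to $\mu_0$ means that $\mu_0(x\colon d(T_n(x),T_0(x))\ge\delta)\to0$ for every $\delta>0$, where $d$ is the metric of $X$. *)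

(* Defs.v *)
From HB Require Import structures.
From mathcomp Require Import all_boot all_order all_algebra.
From mathcomp Require Import all_classical all_reals all_analysis.

Set Implicit Arguments.
Unset Strict Implicit.
Unset Printing Implicit Defensive.
Import Order.TTheory GRing.Theory Num.Theory.
Import numFieldNormedType.Exports.

Local Open Scope classical_set_scope.
Local Open Scope ring_scope.

(* The library puts a measurable structure on pointed types only, hence metric
   spaces with a distinguished point.  This excludes only the empty space, which
   carries no probability measure; the point plays no other role. *)
#[short(type="pmetricType")]
HB.structure Definition PMetric (K : numDomainType) :=
  { M of Metric K M & isPointed M }.

(* On X * X this is the Borel sigma-algebra of the product topology, which for
   nonseparable X may be strictly larger than the product sigma-algebra. *)
Notation borelType T := (g_sigma_algebraType (@open T)).

Local Open Scope ereal_scope.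

Section total_variation.
Context d (T : measurableType d) (R : realType).

(* |nu|(T) = nu^+(T) + nu^-(T), for a Hahn decomposition chosen by [cid]; the
   value does not depend on the choice, by [Hahn_decomposition_uniq]. *)
Definition total_variation_norm (nu : {charge set T -> \bar R}) : \bar R :=
  let P := cid (Hahn_decomposition nu) in
  let N := cid (projT2 P) in
  charge_variation (projT2 N) [set: T].

Definition probability_diff (P Q : probability T R) : {charge set T -> \bar R} :=
  cadd (charge_of_finite_measure P) (copp (charge_of_finite_measure Q)).

Definition cvg_in_variation (P : nat -> probability T R)
    (Q : probability T R) : Prop :=
  total_variation_norm (probability_diff (P n) Q) @[n --> \oo] --> 0.

End total_variation.

Section measures_on_metric_space.
Context {R : realType} {X : pmetricType R}.
Implicit Types (mu nu : probability (borelType X) R).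
Implicit Types (sigma : probability (borelType (X * X)%type) R).
Implicit Types (h : X * X -> R) (T : X -> X).

Definition radon mu : Prop :=
  forall B : set (borelType X), measurable B ->
  forall e : R, (0 < e)%R ->
  exists K : set X, [/\ compact K, K `<=` B & mu (B `\` K) < e%:E].

Definition uniformly_tight (M : set (probability (borelType X) R)) : Prop :=
  forall e : R, (0 < e)%R ->
  exists K : set X, compact K /\ forall mu, M mu -> mu (~` K) < e%:E.

Definition cvg_weakly (P : nat -> probability (borelType X) R)
    (Q : probability (borelType X) R) : Prop :=
  forall f : X -> R, continuous f -> bounded_fun f ->
  \int[P n]_x (f x)%:E @[n --> \oo] --> \int[Q]_x (f x)%:E.

(* Library measures have unspecified values outside the sigma-algebra, so
   identities between measures are stated on measurable sets only. *)
Definition coupling mu nu sigma : Prop :=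
  forall A : set (borelType X), measurable A ->
  sigma (fst @^-1` A) = mu A /\ sigma (snd @^-1` A) = nu A.

Definition kantorovich_cost mu nu h : \bar R :=
  ereal_inf [set \int[sigma]_z (h z)%:E | sigma in coupling mu nu].

Definition optimal_plan mu nu h sigma : Prop :=
  coupling mu nu sigma /\ \int[sigma]_z (h z)%:E = kantorovich_cost mu nu h.

Definition unique_optimal_plan mu nu h sigma : Prop :=
  optimal_plan mu nu h sigma /\
  forall sigma', optimal_plan mu nu h sigma' ->
  forall B : set (borelType (X * X)%type), measurable B ->
  sigma' B = sigma B.

Definition transport_map mu nu T : Prop :=
  measurable_fun [set: borelType X] (T : borelType X -> borelType X) /\
  forall A : set (borelType X), measurable A -> mu (T @^-1` A) = nu A.

(* For nonseparable X the integrand x |-> h (x, T x) need not be Borel.  For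
   Radon mu and nu and continuous h it agrees mu-a.e. with a Borel function, and
   the library integral of a nonnegative function (a supremum over the simple
   functions below it) is then its integral for the completion of mu. *)
Definition monge_optimal mu nu h T : Prop :=
  transport_map mu nu T /\
  forall S : X -> X, transport_map mu nu S ->
  \int[mu]_x (h (x, T x))%:E <= \int[mu]_x (h (x, S x))%:E.

Definition unique_monge_optimal mu nu h T : Prop :=
  monge_optimal mu nu h T /\
  forall S : X -> X, monge_optimal mu nu h S -> {ae mu, forall x, S x = T x}.

(* sigma is the image of mu under x |-> (x, T x).  For nonseparable X the
   preimage of a Borel set is in general only measurable for the completion of
   mu, where [mu_ext mu], the outer measure of mu, is the completed measure. *)
Definition generated_by mu T sigma : Prop :=
  forall B : set (borelType (X * X)%type), measurable B ->
  sigma B = mu_ext mu [set x : X | B (x, T x)].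

(* The outer measure is used because the set below need not be Borel for
   nonseparable X; on Borel sets it coincides with mu. *)
Definition cvg_in_measure mu (T_ : nat -> X -> X) T : Prop :=
  forall delta : R, (0 < delta)%R ->
  mu_ext mu [set x : X | (delta <= mdist (T_ n x) (T x))%R]
    @[n --> \oo] --> 0.

End measures_on_metric_space.

(* Main.v *)
(* It suffices to bound the mass of the bad sets along every nonprincipal
   ultrafilter U on the indices.  Tightness of the plans sigma_n gives a Borel probability Q on
   X * X with U-lim sigma_n(F) <= Q(F) for closed F; Q couples mu_0 and nu_0, and
   the truncated costs pass to the limit, so that Q costs at most the upper limit
   of the optimal costs.  That limit is at most the cost of sigma_0: for a
   partition of unity phi_j and psi_j = phi_j o T_0, the masses of psi_i under mu_n
   and of phi_j under nu_n nearly agree, and a coupling w of these masses gives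
   the competitor with density sum_ij w_ij psi_i(x) phi_j(y) / (p_i q_j) with
   respect to mu_n (x) nu_n.  Hence Q is optimal and equals sigma_0 by uniqueness.
   Finally, cover a compact set of almost full nu_0-measure by small balls B(y):
   T_n is far from T_0 on T_0^-1(B(y)) only where T_n lies in a closed set F
   disjoint from B(y), and sigma_n(C * F) has limit at most sigma_0(C * F) = 0 for
   the compact subsets C of T_0^-1(B(y)). *)

Require Import Defs.
From HB Require Import structures.
From mathcomp Require Import all_boot all_order all_algebra.
From mathcomp Require Import all_classical all_reals all_analysis.
From mathcomp Require Import measurable_realfun.
From mathcomp Require Import ring lra.

Set Implicit Arguments.
Unset Strict Implicit.
Unset Printing Implicit Defensive.
Import Order.TTheory GRing.Theory Num.Theory.
Import numFieldNormedType.Exports.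

Local Open Scope classical_set_scope.
Local Open Scope ring_scope.
Local Open Scope ereal_scope.

(* Infers the pointed pseudometric structure of X * X. *)
HB.saturate prod.

(** * Limits of tight families of Borel probabilities *)

(** Two features shape the argument. First, [X] may be nonseparable, so that the Borel sigma-algebra
    of [X * X] can exceed the product one; the limit plan and the product measure behind the
    competitor are therefore built directly on the Borel sets, starting from open sets. Second, the
    two marginals converge in different senses. As T_0 is only Borel, the functions psi_j and the
    sets T_0^-1(B(y)) are out of reach of weak convergence, and convergence of mu_n in variation is
    what moves them between mu_0 and mu_n. For nu_n only the integrals of finitely many continuous
    phi_j are controlled; this suffices because a truncated cost changes little, uniformly for x in
    a compact set, while y stays in the support of a single phi_j. An ultrafilter takes the place of
    subsequences: it makes all the values sigma_n(G) converge at once, and the limit found does not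
    depend on it, since every Q obtained in this way is sigma_0. *)

Section zero_sets.
Context {R : realType}.

Lemma exists_inv_succ_lt (x : R) : (0 < x)%R -> exists k, (k.+1%:R^-1 < x)%R.
Proof.
move=> x0; exists (Num.truncn x^-1).
by rewrite invf_plt ?posrE// Num.Theory.truncnS_gt.
Qed.

(** The balls of [\bar R] are by definition the preimages under [contract] of the balls of [R]. *)
Lemma continuous_contract : continuous (@contract R).
Proof.
move=> x; apply/cvg_ballP => e e0; apply: (filterS _ (nbhsx_ballx x e e0)) => y.
by [].
Qed.

(** The distance to [F] is infinite when [F] is empty; [contract] makes it real and vanishes only at
    0. *)
Lemma closed_zero_set (Y : pseudoMetricType R) (F : set Y) : closed F ->
  exists u : Y -> R, [/\ continuous u, forall y, (0 <= u y)%R &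
    F = [set y | u y = 0%R]].
Proof.
move=> cF; exists (@contract R \o edist_inf F); split.
- move=> y; apply: continuous_comp; first exact: edist_inf_continuous.
  exact: continuous_contract.
- by move=> y; have := edist_inf_ge0 F y; rewrite -le_contract contract0.
- apply/seteqP; split => y /=.
    by move=> Fy; rewrite edist_inf0// contract0.
  move=> /eqP; rewrite contract_eq0 => /eqP y0.
  apply: cF => B; rewrite -nbhs_ballE => -[e /= e0 yeB].
  have : edist_inf F y < e%:E by rewrite y0 lte_fin.
  move=> /ereal_inf_lt[_ [a Fa <-] ya].
  by exists a; split => //; apply: yeB; exact: (@edist_lt_ball _ _ _ (y, a)).
Qed.

End zero_sets.

(* [t] stands for the limit along an ultrafilter of the values of a tight family of
   probabilities on open sets.  It is only finitely subadditive, but its outer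
   envelope is a Borel probability. *)
Section open_envelope.
Context {R : realType} {Y : pseudoPMetricType R} (t : set Y -> R).
Hypotheses (t0 : t set0 = 0%R) (tT : (t setT <= 1)%R)
  (t_superadd : forall A B G, open A -> open B -> open G ->
    A `&` B = set0 -> A `|` B `<=` G -> (t A + t B <= t G)%R)
  (t_subadd : forall A B, open A -> open B -> (t (A `|` B) <= t A + t B)%R)
  (t_tight : forall e : R, (0 < e)%R -> exists K, compact K /\
    forall G, open G -> K `<=` G -> (1 - e <= t G)%R)
  (t_ge0 : forall A, open A -> (0 <= t A)%R).

(** [mu_ext] ranges over countable covers by measurable sets. The value [+oo] discards the covers
    with a non-open member, so that [open_envelope] is the infimum of the sums of [t] over countable
    open covers. *)
Definition open_weight (A : set (borelType Y)) : \bar R :=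
  if `[< open (A : set Y) >] then (t A)%:E else +oo.

Local Notation rho := open_weight.

Lemma open_weight0 : rho set0 = 0.
Proof. by rewrite /rho asboolT ?t0//; exact: open0. Qed.

Lemma open_weight_ge0 A : 0 <= rho A.
Proof. by rewrite /rho; case: ifPn => // /asboolP oA; rewrite lee_fin t_ge0. Qed.

Lemma open_weightE (G : set Y) : open G -> rho G = (t G)%:E.
Proof. by move=> oG; rewrite /rho asboolT. Qed.

Definition open_envelope (A : set (borelType Y)) : \bar R := mu_ext rho A.

Local Notation mu := open_envelope.

HB.instance Definition _ := isOuterMeasure.Build R (borelType Y) mu
  (mu_ext0 open_weight0 open_weight_ge0)
  (mu_ext_ge0 open_weight_ge0) (le_mu_ext rho)
  (mu_ext_sigma_subadditive open_weight_ge0).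

Lemma open_envelope_le (G : set Y) : open G -> mu G <= (t G)%:E.
Proof.
move=> oG; rewrite -open_weightE//; apply: ereal_inf_lbound.
exists (fun n => if n is 0%N then G else set0).
  by split=> [[|n]|y Gy]; [exact: sub_sigma_algebra|exact: measurable0|exists 0%N].
apply/cvg_lim => //; rewrite -cvg_shiftS.
rewrite (_ : [sequence _]_n = cst (rho G)); first exact: cvg_cst.
rewrite funeqE => n /=; rewrite big_nat_recl//= big1 ?adde0// => i _.
exact: open_weight0.
Qed.

(* Caratheodory's metric argument: if [F] is the zero set of [u], the layers
   [{r_(j+2) < u < r_j}] with [j] of a given parity are disjoint, so that the
   weights of those close to [F] are the tail of a convergent series. *)
Lemma open_envelope_split (F G : set Y) : closed F -> open G ->
  mu (G `&` F) + mu (G `&` ~` F) <= (t G)%:E.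
Proof.
move=> cF oG.
have [u [cu u_ge0 Fu]] := closed_zero_set cF.
have ou (a : R) : open [set y | (a < u y)%R].
  by apply: (@open_comp _ _ u [set x | (a < x)%R]) => //; exact: open_gt.
have ou' (a : R) : open [set y | (u y < a)%R].
  by apply: (@open_comp _ _ u [set x | (x < a)%R]) => //; exact: open_lt.
pose r k : R := (k.+1%:R^-1)%R.
have rS k j : (k <= j)%N -> (r j <= r k)%R.
  by move=> kj; rewrite /r lef_pV2 ?posrE// ler_nat.
pose D k := G `&` [set y | (r k < u y)%R].
have oD k : open (D k) by exact: openI.
pose d k := t (D k).
pose L j := G `&` [set y | (r j.+2 < u y)%R] `&` [set y | (u y < r j)%R].
have oL j : open (L j) by apply: openI => //; exact: openI.
have t_le A B : open A -> open B -> A `<=` B -> (t A <= t B)%R.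
  move=> oA oB AB; have := @t_superadd A set0 B oA open0 oB.
  by rewrite t0 addr0 setI0 setU0; exact.
(* [L j] and [D j] are disjoint inside [D j.+2]. Summed over [j], these bounds telescope in steps of
   two and leave two terms at each end. *)
have Ld j : (t (L j) + d j <= d j.+2)%R.
  apply: t_superadd => //.
    apply/seteqP; split=> // y [[[_ _] /= uy] [_ /= ry]].
    by have := lt_trans uy ry; rewrite ltxx.
  move=> y [[[Gy ?] _]|[Gy /= ry]]; split => //=.
  by apply: le_lt_trans ry; apply: rS; rewrite ltnW.
have Sd k j : (k <= j)%N -> (d k <= d j)%R.
  move=> kj; apply: t_le => // y [Gy /= ry]; split => //=.
  by apply: le_lt_trans ry; exact: rS.
have has_supd : has_sup (range d).
  split; first by exists (d 0%N), 0%N.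
  exists (t G) => _ [k _ <-]; apply: t_le => //; exact: subIsetl.
have dl k : (d k <= sup (range d))%R by apply: sup_upper_bound => //; exists k.
set l := sup (range d) in dl.
apply/lee_addgt0Pr => /= e e0.
(* One third pays for [d N.+1 - d N], the other two for the two differences left by the telescoping
   sum. *)
have e30 : (0 < e / 3)%R by rewrite divr_gt0.
have [_ [N _ <-]] := sup_adherent e30 has_supd; rewrite -/l => lN.
have muGF : mu (G `&` F) <= (t G - d N)%:E.
  apply: (@le_trans _ _ (mu (G `&` [set y | (u y < r N)%R]))).
    apply: le_outer_measure => y [Gy]; rewrite Fu => /= uy; split => //=.
    by rewrite uy /r invr_gt0.
  apply: (le_trans (open_envelope_le _)); first exact: openI.
  rewrite lee_fin lerBrDr; apply: t_superadd => //; first exact: openI.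
    apply/seteqP; split=> // y [[_ /= uy] [_ /= ry]].
    by have := lt_trans uy ry; rewrite ltxx.
  by move=> y [[]|[]].
have Lsum n : (\sum_(0 <= j < n) t (L (N + j)%N) <=
    d (N + n)%N.+1 + d (N + n)%N - d N.+1 - d N)%R.
  elim: n => [|n ih]; first by rewrite big_geq// addn0; lra.
  rewrite big_nat_recr//= addnS.
  have := Ld (N + n)%N; lra.
have muL : mu (\bigcup_j L (N + j)%N) <= (2 * (e / 3))%:E.
  apply: (le_trans (outer_measure_sigma_subadditive mu _)).
  apply: lime_le.
    by apply: is_cvg_nneseries => *; exact: outer_measure_ge0.
  apply: nearW => n; apply: (@le_trans _ _ (\sum_(0 <= j < n) (t (L (N + j)%N))%:E)).
    by apply: lee_sum => j _; exact: open_envelope_le.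
  rewrite sumEFin lee_fin (le_trans (Lsum n))//.
  have := Sd N N.+1 (leqnSn _); have := dl (N + n)%N; have := dl (N + n)%N.+1.
  lra.
have muGF' : mu (G `&` ~` F) <= (d N.+1 + 2 * (e / 3))%:E.
  rewrite EFinD; apply: (@le_trans _ _ (mu (D N.+1 `|` \bigcup_j L (N + j)%N))).
    apply: le_outer_measure => y [Gy]; rewrite Fu => /= /eqP uy0.
    have uy : (0 < u y)%R by rewrite lt_neqAle eq_sym uy0 u_ge0.
    have [ry|ry] := ltP (r N.+1) (u y); [by left|right].
    have [k [rk kr]] : exists k, (r k.+1 < u y /\ u y <= r k)%R.
      have ex : exists k, (r k < u y)%R by exact: exists_inv_succ_lt.
      case: (ex_minnP ex) => -[|k] rk mk.
        by have := lt_le_trans rk ry; rewrite ltNge rS.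
      exists k; split => //; rewrite leNgt; apply/negP => /mk.
      by rewrite ltnn.
    have Nk : (N < k)%N.
      rewrite ltnNge; apply/negP => kN.
      by have := lt_le_trans rk ry; rewrite ltNge rS// ltnS.
    (* The layer has index [k.-1], since [r k.+1 < u y <= r k < r k.-1]; overlapping layers absorb
       the case [u y = r k]. *)
    exists (k.-1 - N)%N => //; rewrite subnKC; last by rewrite -ltnS prednK// (leq_trans _ Nk).
    case: k Nk rk kr => // k _ rk kr /=; split; first by split.
    by apply: le_lt_trans kr _; rewrite /r /= ltf_pV2 ?posrE// ltr_nat.
  apply: (le_trans (outer_measureU2 _ _ _)); apply: leeD => //.
  exact: open_envelope_le.
apply: (le_trans (leeD muGF muGF')); rewrite -!EFinD lee_fin.
by have := dl N.+1; lra.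
Qed.

(** An arbitrary set is split by splitting every member of a cover: open members by
    [open_envelope_split], the others having infinite weight. *)
Lemma open_envelope_caratheodory (F : set Y) : closed F ->
  caratheodory_measurable mu F.
Proof.
move=> cF; apply: le_caratheodory_measurable => A.
apply: le_ereal_inf_tmp => _ [B [_ AB] <-].
have split k : mu (B k `&` F) + mu (B k `&` ~` F) <= rho (B k).
  rewrite /rho; case: ifPn => [/asboolP oB|_]; last exact: leey.
  exact: open_envelope_split.
apply: (@le_trans _ _ (\sum_(k <oo) (mu (B k `&` F) + mu (B k `&` ~` F)))); last first.
  by apply: lee_nneseries => // k _ _; rewrite adde_ge0// outer_measure_ge0.
rewrite nneseriesD; last 2 first.
- by move=> *; exact: outer_measure_ge0.
- by move=> *; exact: outer_measure_ge0.
apply: leeD; (apply: le_trans (outer_measure_sigma_subadditive mu _);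
  apply: le_outer_measure => y [/AB[k _ Bky] Fy]; by exists k).
Qed.

Lemma open_envelope_borel (A : set (borelType Y)) :
  measurable A -> caratheodory_measurable mu A.
Proof.
have : <<s @open Y >> `<=` caratheodory_measurable mu; last exact.
apply: smallest_sub.
  split; first exact: caratheodory_measurable_set0.
  - by move=> B mB; rewrite setTD; exact: caratheodory_measurable_setC.
  - by move=> F mF; exact: caratheodory_measurable_bigcup.
move=> G oG; rewrite -(setCK G); apply: caratheodory_measurable_setC.
by apply: open_envelope_caratheodory; exact: open_closedC.
Qed.

Let open_envelope_sigma_additive : semi_sigma_additive (mu : set (borelType Y) -> _).
Proof.
move=> F mF tF mUF; apply: caratheodory_measure_sigma_additive => //.
- by move=> i; exact: open_envelope_borel.
- exact: open_envelope_borel.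
Qed.

HB.instance Definition _ := isMeasure.Build _ (borelType Y) R mu
  (outer_measure0 mu) (outer_measure_ge0 mu) open_envelope_sigma_additive.

(** Tightness enters in the lower bound: a countable open cover of the space has a finite subfamily
    covering [K], for which the finite subadditivity of [t] is enough. *)
Let open_envelopeT : mu [set: borelType Y] = 1.
Proof.
apply/eqP; rewrite eq_le; apply/andP; split.
  by apply: (le_trans (open_envelope_le openT)); rewrite lee_fin.
apply/lee_addgt0Pr => e e0; rewrite -leeBlDr//.
apply: le_ereal_inf_tmp => _ [B [_ TB] <-].
have [oB|] := pselect (forall k, open (B k : set Y)); last first.
  move/existsNP => [k oBk]; rewrite (eseries_pinfty _ _ (_ : rho (B k) = +oo)) ?leey//.
    by move=> n _; rewrite gt_eqF// (lt_le_trans _ (open_weight_ge0 _)).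
  by rewrite /rho asboolF.
have [K [cK Ke]] := t_tight e0.
have [n Kn] : exists n, K `<=` \big[setU/set0]_(k < n) B k.
  move: cK; rewrite compact_cover => /(_ nat setT B).
  move=> /(_ (fun i _ => oB i) (fun y _ => TB y I))[D' _ KD'].
  exists (\max_(i <- finmap.enum_fset D') i).+1 => y /KD'[i /= iD' By].
  rewrite -bigcup_mkord; exists i => //=; rewrite ltnS.
  exact: leq_bigmax_seq.
have tn : (t (\big[setU/set0]_(k < n) B k) <= \sum_(k < n) t (B k))%R.
  elim: n {Kn} => [|n ih]; first by rewrite !big_ord0 t0.
  rewrite !big_ord_recr/=; apply: (le_trans (t_subadd _ _)) => //.
    by rewrite -bigcup_mkord; apply: bigcup_open => i _; exact: oB.
  by rewrite lerD2r.
apply: (@le_trans _ _ (\sum_(0 <= k < n) rho (B k))); last first.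
  by apply: nneseries_lim_ge => *; exact: open_weight_ge0.
rewrite big_mkord (eq_bigr (fun k : 'I_n => (t (B k))%:E)); last first.
  by move=> k _; exact: open_weightE.
rewrite sumEFin -EFinB lee_fin (le_trans _ tn)//; apply: Ke => //.
by rewrite -bigcup_mkord; apply: bigcup_open => i _; exact: oB.
Qed.

HB.instance Definition _ := Measure_isProbability.Build _ (borelType Y) R mu
  open_envelopeT.

Lemma probability_le_open_weight :
  exists P : probability (borelType Y) R, forall G : set Y, open G -> P G <= (t G)%:E.
Proof. by exists mu => G; exact: open_envelope_le. Qed.

End open_envelope.

Section ultralimit.
Context {R : realType} {Y : pseudoPMetricType R}.

Lemma open_borel (G : set Y) : open G -> measurable (G : set (borelType Y)).
Proof. exact: sub_sigma_algebra. Qed.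

Lemma closed_borel (F : set Y) : closed F -> measurable (F : set (borelType Y)).
Proof.
move=> cF; rewrite -(setCK F); apply: measurableC; apply: open_borel.
exact: closed_openC.
Qed.

Lemma ultra_cvg_bounded (U : set_system nat) (v : nat -> R) (a b : R) :
  UltraFilter U -> (forall n, a <= v n <= b)%R ->
  exists l : R, forall e : R, (0 < e)%R -> \forall n \near U, (`|l - v n| < e)%R.
Proof.
move=> UU vab.
have := @segment_compact R a b => /(_ (v @ U) _) [|l [_ lv]].
  by apply: (@filterE _ U) => n /=; rewrite in_itv/= vab.
exists l => e e0.
have [//|Un] := in_ultra_setVsetC [set n | (`|l - v n| < e)%R] UU.
have := lv (v @` [set n | ~ (`|l - v n| < e)%R]) (ball l e).
case.
- by apply: (@filterS _ U _ _ _ _ Un) => n ?; exists n.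
- exact: nbhsx_ballx.
- by move=> _ [[n nb <-]] /nb.
Qed.

(** With [t] the limit along [U] on open sets, [Q G <= t G] for open [G], and complements give the
    bound for closed sets. Tightness is expressed through open [G] containing [K] because a compact
    subset of a pseudometric space need not be Borel. *)
Lemma tight_ultralimit (U : set_system nat) (P : nat -> probability (borelType Y) R) :
  UltraFilter U ->
  (forall e : R, (0 < e)%R -> exists K : set Y, compact K /\
    forall n (G : set Y), open G -> K `<=` G -> (1 - e)%:E <= P n G) ->
  exists Q : probability (borelType Y) R, forall F : set Y, closed F ->
    forall e : R, (0 < e)%R -> \forall n \near U, P n F <= Q F + e%:E.
Proof.
move=> UU tight.
pose v (A : set Y) n : R := fine (P n A).
have vE (A : set Y) n : open A -> (v A n)%:E = P n A.
  by move=> oA; rewrite /v fineK// fin_num_measure//; exact: open_borel.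
have v01 (A : set Y) : open A -> forall n, (0 <= v A n <= 1)%R.
  move=> oA n; rewrite -!lee_fin vE// measure_ge0/=.
  by apply: probability_le1; exact: open_borel.
(* Off the open sets the value of [t] is arbitrary. *)
have limv (A : set Y) : exists l : R, open A ->
    forall e : R, (0 < e)%R -> \forall n \near U, (`|l - v A n| < e)%R.
  have [oA|?] := pselect (open A); last by exists 0%R.
  have [l lv] := ultra_cvg_bounded UU (v01 _ oA).
  by exists l.
have [t tv] := choice limv.
have t_near (A : set Y) : open A -> forall e : R, (0 < e)%R ->
    \forall n \near U, (t A - e < v A n < t A + e)%R.
  move=> oA e e0; apply: filterS (tv _ oA e e0) => n.
  by rewrite ltr_norml => /andP[]; lra.
have [||||||Q Qt] := @probability_le_open_weight R Y t.
- apply/eqP; rewrite eq_le; apply/andP; split; apply/ler_addgt0Pl => e e0;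
    have [n] := filter_ex (t_near _ open0 e e0);
    rewrite /v measure0/= => /andP[]; lra.
- apply/ler_addgt0Pl => e e0; have [n] := filter_ex (t_near _ openT e e0).
  by rewrite /v probability_setT/= => /andP[]; lra.
- move=> A B G oA oB oG AB ABG; apply/ler_addgt0Pl => e e0.
  have e30 : (0 < e / 3)%R by rewrite divr_gt0.
  have [n [[/andP[A1 A2] /andP[B1 B2]] /andP[G1 G2]]] := filter_ex (filterI (filterI
    (t_near _ oA _ e30) (t_near _ oB _ e30)) (t_near _ oG _ e30)).
  have : (v A n + v B n <= v G n)%R.
    rewrite -lee_fin EFinD !vE// -measureU//; try exact: open_borel.
    by apply: le_measure => //; rewrite inE; apply: open_borel => //; exact: openU.
  lra.
- move=> A B oA oB; apply/ler_addgt0Pl => e e0.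
  have e30 : (0 < e / 3)%R by rewrite divr_gt0.
  have [n [[/andP[A1 A2] /andP[B1 B2]] /andP[G1 G2]]] := filter_ex (filterI (filterI
    (t_near _ oA _ e30) (t_near _ oB _ e30)) (t_near _ (openU oA oB) _ e30)).
  have : (v (A `|` B) n <= v A n + v B n)%R.
    rewrite -lee_fin EFinD !vE//; last exact: openU.
    by apply: measureU2; exact: open_borel.
  lra.
- move=> e e0; have [K [cK Ke]] := tight _ e0; exists K; split => // G oG KG.
  apply/ler_addgt0Pl => d d0; have [n /andP[_ ?]] := filter_ex (t_near _ oG _ d0).
  have := Ke n G oG KG; rewrite -vE// lee_fin; lra.
- move=> A oA; apply/ler_addgt0Pl => e e0.
  have [n /andP[_ ?]] := filter_ex (t_near _ oA _ e0).
  by have /andP[] := v01 _ oA n; lra.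
exists Q => F cF e e0.
have oF := closed_openC cF.
apply: filterS (t_near _ oF _ e0) => n /andP[tn _].
have := Qt _ oF; rewrite -[in P n _](setCK F) -[in Q F](setCK F).
have mF := open_borel oF.
rewrite [P n _]probability_setC// [Q (~` ~` F)]probability_setC// -(vE _ n oF).
rewrite -(fineK (fin_num_measure Q _ mF)).
rewrite -!EFinD -?EFinN -?EFinD !lee_fin; lra.
Qed.

End ultralimit.

Section borel_functions.
Context {R : realType}.

Lemma continuous_borel (Y Z : pseudoPMetricType R) (f : Y -> Z) : continuous f ->
  measurable_fun [set: borelType Y] (f : borelType Y -> borelType Z).
Proof.
move=> /continuousP cf; apply: (measurability (rT := borelType Z) (@open Z)) => //.
by move=> _ [B oB <-]; rewrite setTI; apply: open_borel; exact: cf.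
Qed.

Lemma continuous_borel_real (Y : pseudoPMetricType R) (f : Y -> R) : continuous f ->
  measurable_fun [set: borelType Y] (f : borelType Y -> R).
Proof.
move=> /continuousP cf; apply: (measurability _ (RGenOpens.measurableE R)).
move=> _ [_ [a [b ->] <-]]; rewrite setTI; apply: open_borel; apply: cf.
exact: interval_open.
Qed.

(** For probabilities a one-sided bound is enough: complements reverse it on open sets, and a closed
    set is a decreasing limit of open ones. The closed sets are a pi-system generating the Borel
    sets. *)
Lemma closed_dominated_eq (Y : pseudoPMetricType R)
    (P Q : probability (borelType Y) R) :
  (forall F : set Y, closed F -> Q F <= P F) ->
  forall B : set (borelType Y), measurable B -> P B = Q B.
Proof.
move=> QP.
have PQ (G : set Y) : open G -> P G <= Q G.
  move=> oG; have oF := open_closedC oG; have := QP _ oF.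
  rewrite -[in P G](setCK G) -[in Q G](setCK G).
  have mF := closed_borel oF.
  rewrite [P (~` ~` G)]probability_setC// [Q (~` ~` G)]probability_setC//.
  exact: leeB.
apply: (@measure_unique _ R (borelType Y) (@closed Y) (fun=> setT)) => //.
- apply/seteqP; split.
    apply: smallest_sub; first exact: smallest_sigma_algebra.
    move=> G oG; rewrite -(setCK G) -setTD; apply: sigma_algebraCD.
    by apply: sub_gen_smallest; exact: open_closedC.
  apply: smallest_sub; first exact: smallest_sigma_algebra.
  by move=> F cF; exact: closed_borel.
- by move=> A B cA cB; exact: closedI.
- by rewrite bigcup_const//; exists 0%N.
- move=> F cF; apply/eqP; rewrite eq_le QP// andbT.
  have [u [cu u_ge0 Fu]] := closed_zero_set cF.
  pose G k := [set y | (u y < k.+1%:R^-1)%R].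
  have oG k : open (G k).
    by apply: (@open_comp _ _ u [set x | (x < k.+1%:R^-1)%R]) => //; exact: open_lt.
  have FG : F = \bigcap_k G k.
    rewrite Fu; apply/seteqP; split => y /=.
      by move=> uy k _; rewrite /G/= uy invr_gt0.
    move=> yG; apply/eqP; rewrite eq_le u_ge0 andbT leNgt; apply/negP.
    move=> /exists_inv_succ_lt[k] ky; have /= := yG k I.
    by move/(lt_trans ky); rewrite ltxx.
  have cvgG (S : probability (borelType Y) R) : S (G n) @[n --> \oo] --> S F.
    rewrite FG; apply: nonincreasing_cvg_mu => //.
    - by rewrite (le_lt_trans (probability_le1 _ _)) ?ltry//; exact: open_borel.
    - by move=> k; exact: open_borel.
    - by rewrite -FG; exact: closed_borel.
    - move=> m n mn; apply/subsetPset => y /=; rewrite /G/= => /lt_le_trans; apply.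
      by rewrite lef_pV2 ?posrE// ler_nat.
  by apply: (lee_cvg_to (cvgG P) (cvgG Q)); apply: nearW => k; exact: PQ.
- by move=> _; rewrite -ge0_fin_numE// fin_num_measure.
Qed.

End borel_functions.

(** * Convergence of integrals and couplings *)

Section layers.
Context d (T : measurableType d) {R : realType}.
Implicit Types P Q : probability T R.

Lemma cvg_in_variation_near (P : nat -> probability T R) Q :
  cvg_in_variation P Q -> forall e : R, (0 < e)%R -> \forall n \near \oo,
  forall A, measurable A -> P n A <= Q A + e%:E /\ Q A <= P n A + e%:E.
Proof.
move=> PQ e e0.
have e_nbhs : nbhs (0 : \bar R) [set x | x < e%:E].
  by apply: open_nbhs_nbhs; split; [exact: open_ereal_lt_ereal|rewrite /= lte_fin].
have [N _ PQN] := PQ _ e_nbhs; exists N => // n /PQN.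
rewrite /= /total_variation_norm.
set nuPN := (X in charge_variation X) => tv A mA.
have : `|probability_diff (P n) Q A| <= e%:E.
  apply: (le_trans (abse_charge_variation nuPN mA)).
  by apply: (le_trans _ (ltW tv)); rewrite le_measure ?inE.
have -> : probability_diff (P n) Q A = P n A - Q A.
  by rewrite /probability_diff/cadd/= /copp/=.
rewrite -(fineK (fin_num_measure (P n) _ mA)) -(fineK (fin_num_measure Q _ mA)).
by rewrite -EFinB/= !lee_fin ler_norml => /andP[]; split; lra.
Qed.

(** The sum is [m] times the number of levels [m * k], [k < n], strictly below [y]. The inequality
    is strict so that for continuous [f] the sets [m * k < f] are open. *)
Lemma layer_bounds (m y : R) n : (0 <= m)%R -> (0 <= y)%R ->
  (Num.min y (m * n%:R) <= \sum_(k < n) m * (m * k%:R < y)%R%:R <= y + m)%R.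
Proof.
move=> m0 y0.
have sle k : (\sum_(i < k) m * (m * i%:R < y)%R%:R <= m * k%:R)%R.
  rewrite -mulr_sumr ler_wpM2l// -natr_sum ler_nat.
  by rewrite -[leqRHS]card_ord -sum1_card leq_sum// => i _; exact: leq_b1.
elim: n => [|n /andP[ih1 ih2]].
  by rewrite big_ord0 mulr0 ge_min lexx orbT/= addr_ge0.
rewrite big_ord_recr/=; have [ny|yn] := ltP (m * n%:R)%R y.
  rewrite mulr1; move: ih1; rewrite (min_r (ltW ny)) => ih1; apply/andP; split.
    by rewrite ge_min -natr1 mulrDr mulr1 lerD2r ih1 orbT.
  by rewrite lerD2r (le_trans (sle n))// ltW.
rewrite mulr0 addr0 ih2 andbT; move: ih1; rewrite min_l// => ih1.
by rewrite ge_min ih1.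
Qed.

(** A discrete layer-cake formula: [n.+1] levels of height [M / n.+1], each with error [e],
    contribute [M * e], and replacing [f] by its staircase contributes one step height. *)
Lemma integral_le_layers P Q (f : T -> R) (M e : R) n :
  measurable_fun setT f -> (forall x, 0 <= f x <= M)%R -> (0 <= e)%R ->
  (forall k, (k < n.+1)%N -> P [set x | (M / n.+1%:R * k%:R < f x)%R] <=
    Q [set x | (M / n.+1%:R * k%:R < f x)%R] + e%:E) ->
  \int[P]_x (f x)%:E <= \int[Q]_x (f x)%:E + (M * e + M / n.+1%:R)%:E.
Proof.
move=> mf f0M e0 PQ; set m := (M / n.+1%:R)%R in PQ *.
have M0 : (0 <= M)%R by have /andP[/le_trans] := f0M point; apply.
have m0 : (0 <= m)%R by rewrite divr_ge0.
pose A k := [set x | (m * k%:R < f x)%R].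
have mA k : measurable (A k).
  rewrite (_ : A k = f @^-1` `](m * k%:R)%R, +oo[%classic).
    by rewrite -[X in measurable X]setTI; exact: mf.
  by apply/seteqP; split => x /=; rewrite in_itv/= andbT.
have sA x : (\sum_(k < n.+1) m * (m * k%:R < f x)%R%:R = \sum_(k < n.+1) m * \1_(A k) x)%R.
  by apply: eq_bigr => k _; rewrite indicE mem_setE.
have ints (S : probability T R) : \int[S]_x (\sum_(k < n.+1) m * \1_(A k) x)%:E =
    \sum_(k < n.+1) m%:E * S (A k).
  under eq_integral do rewrite -sumEFin.
  rewrite ge0_integral_sum//; last 2 first.
  - by move=> k; apply/measurable_EFinP/measurable_funM => //; exact: measurable_indic.
  - by move=> k x _; rewrite lee_fin mulr_ge0.
  apply: eq_bigr => k _; under eq_integral do rewrite EFinM.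
  rewrite ge0_integralZl_EFin//.
  - by rewrite integral_indic// setIT.
  - by apply/measurable_EFinP; exact: measurable_indic.
have ms : measurable_fun setT (fun x => (\sum_(k < n.+1) m * \1_(A k) x)%R).
  apply: measurable_sum => k; apply: measurable_funM => //; exact: measurable_indic.
have s0 x : (0 <= \sum_(k < n.+1) m * \1_(A k) x)%R.
  by apply: sumr_ge0 => k _; rewrite mulr_ge0.
have fge0 x : (0 <= f x)%R by have /andP[] := f0M x.
have mE : (m * n.+1%:R = M)%R by rewrite /m divfK.
apply: (@le_trans _ _ (\int[P]_x (\sum_(k < n.+1) m * \1_(A k) x)%:E)).
  apply: ge0_le_integral => //.
  - by move=> x _; rewrite lee_fin.
  - exact/measurable_EFinP.
  - exact/measurable_EFinP.
  - move=> x _; rewrite lee_fin -sA; have /andP[_ fM] := f0M x.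
    have /andP[+ _] := layer_bounds n.+1 m0 (fge0 x).
    by rewrite mE min_l.
rewrite ints; apply: (@le_trans _ _ (\sum_(k < n.+1) m%:E * (Q (A k) + e%:E))).
  by apply: lee_sum => k _; apply: lee_wpmul2l; [rewrite lee_fin|exact: PQ].
under eq_bigr do rewrite muleDr// ?fin_num_adde_defl//.
rewrite big_split/= -ints.
have -> : \sum_(k < n.+1) (m%:E * e%:E) = (M * e)%:E.
  rewrite (eq_bigr (fun=> (m * e)%:E))// sumEFin sumr_const card_ord.
  by rewrite -mulr_natr mulrAC mE.
have sQ : \int[Q]_x (\sum_(k < n.+1) m * \1_(A k) x)%:E <= \int[Q]_x (f x)%:E + m%:E.
  rewrite -[m%:E in leRHS]mule1 -(probability_setT Q) -integral_cst//.
  rewrite -ge0_integralD//;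
    [|by move=> x _; rewrite lee_fin|exact/measurable_EFinP].
  apply: ge0_le_integral => //.
  - by move=> x _; rewrite lee_fin.
  - exact/measurable_EFinP.
  - by apply: emeasurable_funD => //; exact/measurable_EFinP.
  - move=> x _; rewrite -EFinD lee_fin -sA.
    by have /andP[] := layer_bounds n.+1 m0 (fge0 x).
by apply: (le_trans (leeD2r _ sQ)); rewrite -addeA -EFinD [(m + _)%R]addrC.
Qed.
End layers.

Section integral_limits.
Context d (T : measurableType d) {R : realType}.

Lemma integral_le_near (F : set_system nat) {FF : Filter F}
    (P Q : nat -> probability T R) (f : T -> R) (M : R) :
  measurable_fun setT f -> (forall x, 0 <= f x <= M)%R ->
  (forall a e : R, (0 < e)%R -> \forall n \near F,
    P n [set x | (a < f x)%R] <= Q n [set x | (a < f x)%R] + e%:E) ->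
  forall e : R, (0 < e)%R -> \forall n \near F,
    \int[P n]_x (f x)%:E <= \int[Q n]_x (f x)%:E + e%:E.
Proof.
move=> mf f0M PQ e e0.
have M0 : (0 <= M)%R by have /andP[/le_trans] := f0M point; apply.
have [N MN] : exists N, (M / N.+1%:R < e / 2)%R.
  have [|N] := @exists_inv_succ_lt R (e / 2 / (M + 1))%R.
    by rewrite !divr_gt0// ltr_wpDl.
  rewrite ltr_pdivlMr ?ltr_wpDl// => MN; exists N; apply: le_lt_trans MN.
  by rewrite mulrC ler_wpM2l// lerDl.
set m := (M / N.+1%:R)%R in MN.
(* Dividing by [M + 1] rather than [M] covers [M = 0]. *)
have e'0 : (0 < e / 2 / (M + 1))%R by rewrite !divr_gt0// ltr_wpDl.
have := @filter_forall _ 'I_N.+1 (fun k n =>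
  P n [set x | (m * k%:R < f x)%R] <=
  Q n [set x | (m * k%:R < f x)%R] + (e / 2 / (M + 1))%:E) F FF (fun k => PQ _ _ e'0).
apply: filterS => n PQn.
apply: le_trans (integral_le_layers mf f0M (ltW e'0) _) _.
  by move=> k kN; exact: (PQn (Ordinal kN)).
apply: leeD2l; rewrite lee_fin -/m.
have : (M * (e / 2 / (M + 1)) <= e / 2)%R.
  by rewrite mulrA ler_pdivrMr ?ltr_wpDl// mulrC ler_wpM2l ?divr_ge0 ?ltW// ltrDl.
lra.
Qed.

Lemma measure_le_integral (P : {measure set T -> \bar R}) (A : set T) (v : T -> R) :
  measurable A -> measurable_fun setT v -> (forall x, 0 <= v x)%R ->
  (forall x, A x -> 1 <= v x)%R -> P A <= \int[P]_x (v x)%:E.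
Proof.
move=> mA mv v0 v1; rewrite -[A in P A]setIT -integral_indic//.
apply: ge0_le_integral => //.
- by apply/measurable_EFinP; exact: measurable_indic.
- exact/measurable_EFinP.
- by move=> x _; rewrite lee_fin indicE; case: (boolP (x \in A)) => [/set_mem/v1|].
Qed.

Lemma integral_le_measure (P : {measure set T -> \bar R}) (A : set T) (v : T -> R) :
  measurable A -> measurable_fun setT v -> (forall x, 0 <= v x <= 1)%R ->
  (forall x, ~ A x -> v x = 0)%R -> \int[P]_x (v x)%:E <= P A.
Proof.
move=> mA mv v01 v0; rewrite -[A in P A]setIT -integral_indic//.
apply: ge0_le_integral => //.
- by move=> x _; rewrite lee_fin; have /andP[] := v01 x.
- exact/measurable_EFinP.
- by apply/measurable_EFinP; exact: measurable_indic.
- move=> x _; rewrite lee_fin indicE; case: (boolP (x \in A)) => [_|].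
    by have /andP[] := v01 x.
  by rewrite notin_setE => /v0 ->.
Qed.

Lemma integral01_fin_num (P : probability T R) (v : T -> R) :
  measurable_fun setT v -> (forall x, 0 <= v x <= 1)%R ->
  \int[P]_x (v x)%:E \is a fin_num.
Proof.
move=> mv v01; rewrite ge0_fin_numE; last first.
  by apply: integral_ge0 => x _; rewrite lee_fin; have /andP[] := v01 x.
apply: (@le_lt_trans _ _ (P setT)); last by rewrite probability_setT ltry.
by apply: integral_le_measure => // x; case.
Qed.

End integral_limits.

Section couplings.
Context {R : realType} {X : pmetricType R}.
Implicit Types (mu nu : probability (borelType X) R).
Implicit Types (sigma : probability (borelType (X * X)%type) R).

Lemma fst_borel : measurable_fun [set: borelType (X * X)%type]
  (fst : borelType (X * X)%type -> borelType X).
Proof. by apply: continuous_borel => z; exact: cvg_fst. Qed.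

Lemma snd_borel : measurable_fun [set: borelType (X * X)%type]
  (snd : borelType (X * X)%type -> borelType X).
Proof. by apply: continuous_borel => z; exact: cvg_snd. Qed.

Definition borel_fst : borelType (X * X)%type -> borelType X := fst.
Definition borel_snd : borelType (X * X)%type -> borelType X := snd.

HB.instance Definition _ := @isMeasurableFun.Build _ _ _ _ borel_fst fst_borel.
HB.instance Definition _ := @isMeasurableFun.Build _ _ _ _ borel_snd snd_borel.

Lemma preimage_fst_borel (A : set (borelType X)) : measurable A ->
  measurable (fst @^-1` A : set (borelType (X * X)%type)).
Proof. by move=> mA; rewrite -[X in measurable X]setTI; exact: fst_borel. Qed.

Lemma preimage_snd_borel (A : set (borelType X)) : measurable A ->
  measurable (snd @^-1` A : set (borelType (X * X)%type)).
Proof. by move=> mA; rewrite -[X in measurable X]setTI; exact: snd_borel. Qed.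

Lemma setX_borel (A B : set (borelType X)) : measurable A -> measurable B ->
  measurable (A `*` B : set (borelType (X * X)%type)).
Proof.
move=> mA mB; rewrite (_ : A `*` B = fst @^-1` A `&` snd @^-1` B)//.
by apply: measurableI; [exact: preimage_fst_borel|exact: preimage_snd_borel].
Qed.

Lemma compact_borel (K : set X) : compact K -> measurable (K : set (borelType X)).
Proof.
by move=> cK; apply: closed_borel; apply: compact_closed => //; exact: metric_hausdorff.
Qed.

Lemma coupling_integral_fst mu nu sigma (f : X -> \bar R) : coupling mu nu sigma ->
  measurable_fun [set: borelType X] (f : borelType X -> \bar R) ->
  (forall x, 0 <= f x) -> \int[sigma]_z f z.1 = \int[mu]_x f x.
Proof.
move=> c mf f0; rewrite (eq_measure_integral (pushforward sigma borel_fst)); last first.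
  by move=> A mA _; exact: (esym (c A mA).1).
rewrite ge0_integral_pushforward//; exact: fst_borel.
Qed.

Lemma coupling_integral_snd mu nu sigma (f : X -> \bar R) : coupling mu nu sigma ->
  measurable_fun [set: borelType X] (f : borelType X -> \bar R) ->
  (forall x, 0 <= f x) -> \int[sigma]_z f z.2 = \int[nu]_x f x.
Proof.
move=> c mf f0; rewrite (eq_measure_integral (pushforward sigma borel_snd)); last first.
  by move=> A mA _; exact: (esym (c A mA).2).
rewrite ge0_integral_pushforward//; exact: snd_borel.
Qed.

Lemma coupling_setXC mu nu sigma (A B : set (borelType X)) : coupling mu nu sigma ->
  measurable A -> measurable B ->
  sigma (~` (A `*` B)) <= mu (~` A) + nu (~` B).
Proof.
move=> c mA mB; have [<- _] := c _ (measurableC mA); have [_ <-] := c _ (measurableC mB).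
rewrite (_ : ~` (A `*` B) = fst @^-1` (~` A) `|` snd @^-1` (~` B)).
  apply: measureU2; [apply: preimage_fst_borel|apply: preimage_snd_borel];
  exact: measurableC.
apply/seteqP; split => -[x y] /=.
  by move=> /not_andP.
by move=> [|] h [].
Qed.

Lemma continuous_ramp (u : X -> R) (c : R) : continuous u ->
  continuous (fun y => Num.max 0%R (1 - c * u y)%R).
Proof.
move=> cu y.
apply: (@continuous_max _ X (fun=> 0%R) (fun y => 1 - c * u y)%R).
  exact: cst_continuous.
apply: continuousB; first exact: cst_continuous.
by apply: continuousM; [exact: cst_continuous|exact: cu].
Qed.

Lemma cvg_weakly_near (P : nat -> probability (borelType X) R)
    (Q : probability (borelType X) R) (v : X -> R) :
  cvg_weakly P Q -> continuous v -> (forall x, 0 <= v x <= 1)%R ->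
  forall e : R, (0 < e)%R -> \forall n \near \oo,
  (`|fine (\int[Q]_x (v x)%:E) - fine (\int[P n]_x (v x)%:E)| < e)%R.
Proof.
move=> PQ cv v01 e e0.
have bv : bounded_fun v.
  exists 1%R; split => // M M1 y _ /=; have /andP[vy0 vy1] := v01 y.
  by rewrite ger0_norm// (le_trans vy1)// ltW.
have mv := continuous_borel_real cv.
have := PQ v cv bv; rewrite -(fineK (integral01_fin_num Q mv v01)).
by move=> /fine_cvgP[_] /cvgrPdist_lt/(_ _ e0).
Qed.

(** By [closed_dominated_eq] it is enough that the marginals of [Q] dominate [mu 0] and [nu 0] on
    closed sets. For the first one convergence in variation applies to [F] itself; for the second a
    continuous function has to be put between [F] and a closed neighbourhood [G k]. *)
Lemma coupling_ultralimit (mu nu : nat -> probability (borelType X) R)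
    (sigma : nat -> probability (borelType (X * X)%type) R)
    (U : set_system nat) (Q : probability (borelType (X * X)%type) R) :
  ProperFilter U -> \oo `<=` U ->
  cvg_in_variation mu (mu 0%N) -> cvg_weakly nu (nu 0%N) ->
  (forall n, coupling (mu n) (nu n) (sigma n)) ->
  (forall F : set (X * X)%type, closed F -> forall e : R, (0 < e)%R ->
    \forall n \near U, sigma n F <= Q F + e%:E) ->
  coupling (mu 0%N) (nu 0%N) Q.
Proof.
move=> PU ooU cmu cnu c QF.
have Q1 : forall B : set (borelType X), measurable B ->
    distribution Q borel_fst B = mu 0%N B.
  apply: closed_dominated_eq => F cF; apply/lee_addgt0Pr => e e0.
  have e20 : (0 < e / 2)%R by rewrite divr_gt0.
  have cF1 : closed (fst @^-1` F : set (X * X)%type).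
    by apply: closed_comp => // z _; exact: cvg_fst.
  have mF := closed_borel cF.
  have [n [Qn /(_ F mF)[_ mun]]] := filter_ex (filterI (QF _ cF1 _ e20)
    (ooU _ (cvg_in_variation_near cmu e20))).
  apply: (le_trans mun); rewrite [X in _ <= _ + X%:E]splitr EFinD addeA leeD2r//.
  by have [<- _] := c n F mF.
have Q2 : forall B : set (borelType X), measurable B ->
    distribution Q borel_snd B = nu 0%N B.
  apply: closed_dominated_eq => F cF.
  have [u [cu u_ge0 Fu]] := closed_zero_set cF.
  pose G k := [set y | (u y <= k.+1%:R^-1)%R].
  have cG k : closed (G k).
    apply: (@closed_comp _ _ u [set x | (x <= k.+1%:R^-1)%R]) => // x _; exact: cu.
  have FG : F = \bigcap_k G k.
    rewrite Fu; apply/seteqP; split => y /=.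
      by move=> uy k _; rewrite /G/= uy invr_ge0.
    move=> yG; apply/eqP; rewrite eq_le u_ge0 andbT leNgt; apply/negP.
    by move=> /exists_inv_succ_lt[k]; rewrite ltNge (yG k I).
  have Gle k : nu 0%N F <= distribution Q borel_snd (G k).
    apply/lee_addgt0Pr => e e0.
    have e20 : (0 < e / 2)%R by rewrite divr_gt0.
    have cG2 : closed (snd @^-1` (G k) : set (X * X)%type).
      by apply: closed_comp => // z _; exact: cvg_snd.
    (* [v] is 1 on [F] and vanishes outside [G k]. *)
    pose v y := Num.max 0%R (1 - k.+1%:R * u y)%R.
    have cv : continuous v by exact: continuous_ramp.
    have v01 y : (0 <= v y <= 1)%R.
      by rewrite /v le_max lexx ge_max ler01 gerBl mulr_ge0.
    have mv := continuous_borel_real cv.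
    have Fv : nu 0%N F <= \int[nu 0%N]_x (v x)%:E.
      apply: measure_le_integral => //; first exact: closed_borel.
        by move=> x; have /andP[] := v01 x.
      by move=> x; rewrite Fu => /= ux; rewrite /v ux mulr0 subr0 le_max lexx orbT.
    have vn : \forall n \near U, \int[nu 0%N]_x (v x)%:E <= \int[nu n]_x (v x)%:E + (e / 2)%:E.
      apply: ooU; apply: filterS (cvg_weakly_near cnu cv v01 e20) => n.
      rewrite -{2}(fineK (integral01_fin_num (nu n) mv v01)).
      rewrite -[X in _ -> X <= _](fineK (integral01_fin_num (nu 0%N) mv v01)) -EFinD lee_fin.
      by rewrite ltr_norml => /andP[_]; lra.
    have [n [Qn {}vn]] := filter_ex (filterI (QF _ cG2 _ e20) vn).
    apply: (le_trans Fv); apply: (le_trans vn).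
    rewrite [X in _ <= _ + X%:E]splitr EFinD addeA leeD2r//; apply: (le_trans _ Qn).
    have [_ ->] := c n _ (closed_borel (cG k)).
    apply: integral_le_measure => // [|x]; first exact: closed_borel.
    move=> /negP; rewrite /G/= -ltNge => ux; rewrite /v max_l// subr_le0.
    by rewrite -ler_pdivrMl// mulr1 ltW.
  have cvgG : distribution Q borel_snd (G n) @[n --> \oo] --> distribution Q borel_snd F.
    rewrite FG; apply: nonincreasing_cvg_mu => //.
    - by rewrite -ge0_fin_numE// fin_num_measure//; exact: closed_borel.
    - by move=> k; exact: closed_borel.
    - by rewrite -FG; exact: closed_borel.
    - move=> m n mn; apply/subsetPset => y /=; rewrite /G/= => /le_trans; apply.
      by rewrite lef_pV2 ?posrE// ler_nat.
  by apply: (lee_cvg_to (cvg_cst (nu 0%N F)) cvgG); exact: nearW.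
by move=> A mA; split; [exact: Q1|exact: Q2].
Qed.

End couplings.

(** * Competitors for the transport problem *)

Lemma probability_EFin d (T : measurableType d) (R : realType)
    (P : probability T R) (A : set T) :
  measurable A -> exists r : R, P A = r%:E.
Proof. by move=> mA; exists (fine (P A)); rewrite fineK// fin_num_measure. Qed.

Lemma probability_setD d (T : measurableType d) (R : realType)
    (P : probability T R) (A B : set T) :
  measurable A -> measurable B -> B `<=` A -> P (A `\` B) = P A - P B.
Proof.
move=> mA mB BA; have := @measureD _ _ _ P _ _ mA mB; rewrite setIidr//; apply.
by apply: (le_lt_trans (probability_le1 P mA)); rewrite ltry.
Qed.

Section density.
Context d (T : measurableType d) {R : realType}.
Variables (P : probability T R) (g : T -> R).
Hypotheses (mg : measurable_fun setT g) (g0 : forall x, (0 <= g x)%R)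
  (g1 : \int[P]_x (g x)%:E = 1).

Definition density_measure (A : set T) : \bar R := \int[P]_(x in A) (g x)%:E.

Local Notation nu := density_measure.

Let nu0 : nu set0 = 0. Proof. exact: integral_set0. Qed.

Let nu_ge0 A : 0 <= nu A.
Proof. by apply: integral_ge0 => x _; rewrite lee_fin. Qed.

Let nu_sigma_additive : semi_sigma_additive nu.
Proof.
apply: semi_sigma_additive_nng_induced; first exact/measurable_EFinP.
by move=> x; rewrite lee_fin.
Qed.

HB.instance Definition _ := isMeasure.Build _ T R nu nu0 nu_ge0 nu_sigma_additive.
HB.instance Definition _ := Measure_isProbability.Build _ T R nu g1.

(** The change of variables formula involves the Radon-Nikodym derivative of [nu], which equals [g]
    almost everywhere because both have the same integral over every measurable set. *)
Lemma exists_density : exists Q : probability T R,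
  forall f : T -> R, measurable_fun setT f -> (forall x, 0 <= f x)%R ->
  \int[Q]_x (f x)%:E = \int[P]_x (f x * g x)%:E.
Proof.
exists nu => f mf f0.
have nuP : nu `<< P.
  apply/null_content_dominatesP => A mA PA0; apply: null_set_integral => //.
  exact/measurable_EFinP/measurable_funTS.
rewrite -(Radon_Nikodym_SigmaFinite.change_of_variables nuP)//; last exact/measurable_EFinP.
have intf := Radon_Nikodym_SigmaFinite.f_integrable nuP.
apply: ae_eq_integral => //.
- apply: emeasurable_funM; first exact/measurable_EFinP.
  exact: measurable_int intf.
- by apply/measurable_EFinP; exact: measurable_funM.
- rewrite (_ : (fun x => (f x * g x)%:E) = (EFin \o f) \* (EFin \o g))//.
  apply: ae_eqe_mul2l; apply: integral_ae_eq => //; first exact/measurable_EFinP.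
  by move=> A _ mA; rewrite -Radon_Nikodym_SigmaFinite.f_integral.
Qed.
End density.

Section borel_product.
Context {R : realType} {X : pmetricType R}.

Lemma nbhs_open (Y : topologicalType) (A : set Y) :
  (forall x, A x -> nbhs x A) -> open A.
Proof. by move=> h; rewrite openE => x /h. Qed.

Lemma open_section (G : set (X * X)%type) (x : X) : open G ->
  open [set y | G (x, y)].
Proof.
move=> oG; apply: (@open_comp _ _ (fun y => (x, y)) G) => // y _.
by apply: cvg_pair => //; exact: cvg_cst.
Qed.

Lemma borel_section (B : set (borelType (X * X)%type)) (x : X) : measurable B ->
  measurable ([set y | B (x, y)] : set (borelType X)).
Proof.
have cx : continuous (fun y : X => (x, y)).
  by move=> y; apply: cvg_pair => //; exact: cvg_cst.
move=> mB; rewrite -[X in measurable X]setTI.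
have mx : measurable_fun [set: borelType X]
    ((fun y : X => (x, y)) : borelType X -> borelType (X * X)%type).
  apply: (measurability (rT := borelType (X * X)%type) (@open (X * X)%type)) => //.
  by move=> _ [C oC <-]; rewrite setTI; apply: open_borel; exact: open_section.
exact: mx.
Qed.

(** A compact [K] in the section at [x0] with mass above [t] remains, by the tube lemma, in the
    sections at all nearby points. *)
Lemma open_section_lsc (nu : probability (borelType X) R) (G : set (X * X)%type)
  (t : R) : radon nu -> open G ->
  open [set x : X | t%:E < nu [set y | G (x, y)]].
Proof.
move=> nur oG; apply: nbhs_open => x0 /= tG.
have mGx (x : X) := open_borel (open_section x oG).
have [K [cK KG tK]] : exists K : set X,
    [/\ compact K, K `<=` [set y | G (x0, y)] & t%:E < nu K].
  have [g gE] := probability_EFin nu (mGx x0).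
  have e0 : (0 < g - t)%R by rewrite subr_gt0 -lte_fin -gE.
  have [K [cK KG]] := nur _ (mGx x0) _ e0.
  have mK := compact_borel cK; have [k kE] := probability_EFin nu mK.
  rewrite probability_setD// gE kE -EFinB lte_fin => h; exists K; split => //.
  by rewrite kE lte_fin; lra.
have : \forall x \near x0, K `<=` (fun y => G (x, y)).
  move/compact_near_coveringP : (cK) => /(_ X (nbhs x0) (fun x y => G (x, y)) _).
  apply.
  move=> y /KG /= Gxy.
  have : nbhs (x0, y) G by apply: open_nbhs_nbhs.
  move=> [[A B] /= [Ax By] ABG]; exists (B, A) => //= -[y' x'] [? ?]; exact: ABG.
apply: filterS => x KGx /=; apply: (lt_le_trans tK).
by apply: le_measure => //; rewrite inE//; exact: compact_borel.
Qed.

Lemma section_sigma_additive (nu : probability (borelType X) R)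
    (F : (set (borelType (X * X)%type))^nat) (x : X) :
  (forall n, measurable (F n)) -> trivIset setT F ->
  nu [set y | (\bigcup_k F k) (x, y)] = \sum_(0 <= k <oo) nu [set y | F k (x, y)].
Proof.
move=> mF tF; apply/esym/cvg_lim => //.
apply: (@measure_sigma_additive _ _ _ nu (fun k => [set y | F k (x, y)])).
  by move=> k; exact: borel_section.
apply/trivIsetP => i j _ _ ij; move/trivIsetP : tF => /(_ i j I I ij).
by move=> /seteqP[FF _]; apply/seteqP; split => // y /= [a b]; exact: (FF (x, y)).
Qed.

Lemma measurable_section (nu : probability (borelType X) R) : radon nu ->
  forall B : set (borelType (X * X)%type), measurable B ->
  measurable_fun [set: borelType X] (fun x : borelType X => nu [set y | B (x, y)]).
Proof.
move=> nur.
apply: (dynkin_induction (T := borelType (X * X)%type)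
  (G := @open (X * X)%type)) => //.
- by move=> A B oA oB; exact: openI.
- exact: (@measurable_cst _ _ _ _ _ (nu setT)).
- move=> G oG; apply: (measurability _ (ErealGenOInfty.measurableE R)).
  move=> _ [_ [t ->] <-]; rewrite setTI.
  rewrite (_ : _ @^-1` _ = [set x : X | t%:E < nu [set y | G (x, y)]]).
    by apply: open_borel; exact: open_section_lsc.
  by apply/seteqP; split => x /=; rewrite in_itv/= andbT.
- move=> B mB mf.
  rewrite (_ : (fun x => _) = (fun x : borelType X => 1 - nu [set y | B (x, y)])).
    by apply: emeasurable_funB => //; exact: measurable_cst.
  by apply/funext => x; rewrite -probability_setC//; exact: borel_section.
- move=> F mF tF mfF.
  rewrite (_ : (fun x => _) =
      (fun x : borelType X => \sum_(0 <= k <oo) nu [set y | F k (x, y)])).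
    by apply: ge0_emeasurable_sum.
  by apply/funext => x; exact: section_sigma_additive.
Qed.

Section product_measure.
Variables (mu nu : probability (borelType X) R).
Hypothesis nur : radon nu.

(* The product sigma-algebra may be smaller than the Borel one; [nu] being Radon,
   the sections of an open set have lower semicontinuous measure, and the product
   measure is defined on the Borel sets by integrating the sections. *)
Definition borel_product of radon nu := fun (B : set (borelType (X * X)%type)) =>
  \int[mu]_x nu [set y | B (x, y)].

Local Notation P := (borel_product nur).

Let P0 : P set0 = 0.
Proof.
rewrite /P; under eq_integral do rewrite (_ : [set y | _] = set0)// measure0.
exact: integral0.
Qed.

Let P_ge0 B : 0 <= P B. Proof. by apply: integral_ge0 => x _. Qed.

Let P_sigma_additive : semi_sigma_additive P.
Proof.
move=> F mF tF mUF; rewrite /P.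
under eq_integral do rewrite section_sigma_additive//.
rewrite integral_nneseries//; last by move=> k; exact: measurable_section.
by apply: is_cvg_nneseries => k _ _; exact: P_ge0.
Qed.

HB.instance Definition _ := isMeasure.Build _ (borelType (X * X)%type) R P
  P0 P_ge0 P_sigma_additive.

Let PT : P setT = 1.
Proof.
rewrite /P; under eq_integral do rewrite (_ : [set y | _] = setT)// probability_setT.
by rewrite integral_cst// mul1e; exact: probability_setT.
Qed.

HB.instance Definition _ := Measure_isProbability.Build _ (borelType (X * X)%type) R P PT.

Lemma borel_productX (A B : set (borelType X)) : measurable A -> measurable B ->
  P (A `*` B) = mu A * nu B.
Proof.
move=> mA mB; rewrite /P.
rewrite (eq_integral (fun x => nu B * (\1_A x)%:E)).
  rewrite ge0_integralZl//; last by apply/measurable_EFinP; exact: measurable_indic.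
  by rewrite integral_indic// setIT muleC.
move=> x _; rewrite indicE; case: (boolP (x \in A)) => [/set_mem Ax|].
  by rewrite mule1; congr (nu _); apply/seteqP; split => y //= [].
rewrite notin_setE mule0 => nAx; rewrite (_ : [set y | _] = set0) ?measure0//.
by apply/seteqP; split => y //= [].
Qed.

Lemma borel_product_integralM (f g : X -> R) :
  measurable_fun [set: borelType X] (f : borelType X -> R) ->
  measurable_fun [set: borelType X] (g : borelType X -> R) ->
  (forall x, 0 <= f x)%R -> (forall x, 0 <= g x)%R ->
  \int[P]_z (f z.1 * g z.2)%:E = \int[mu]_x (f x)%:E * \int[nu]_x (g x)%:E.
Proof.
move=> mf mg f0 g0.
(* [phi] is the identity from the Borel to the product sigma-algebra. The integrand is measurable
   for the latter, on which the image of [P] is the usual product measure, so that Tonelli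
   applies. *)
pose phi (z : borelType (X * X)%type) : borelType X * borelType X := z.
have mphi : measurable_fun setT phi.
  by apply/measurable_fun_pairP; split; [exact: fst_borel|exact: snd_borel].
pose phi_mixin := isMeasurableFun.Build _ _ _ _ phi mphi.
pose phi' : {mfun borelType (X * X)%type >-> (borelType X * borelType X)%type} :=
  HB.pack phi phi_mixin.
pose F (z : borelType X * borelType X) := (f z.1 * g z.2)%:E.
have mF : measurable_fun setT F.
  apply/measurable_EFinP; apply: measurable_funM.
    by apply: (measurableT_comp mf); exact: measurable_fst.
  by apply: (measurableT_comp mg); exact: measurable_snd.
have F0 z : 0 <= F z by rewrite lee_fin mulr_ge0.
transitivity (\int[pushforward P phi']_z F z).
  by rewrite ge0_integral_pushforward.
rewrite (eq_measure_integral (mu \x nu)%E); last first.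
  move=> A mA _; apply/esym.
  apply: product_measure_unique => // B C mB mC.
  exact: borel_productX.
rewrite fubini_tonelli1// /fubini_F.
have FE x : \int[nu]_y F (x, y) = (f x)%:E * \int[nu]_y (g y)%:E.
  rewrite -ge0_integralZl ?lee_fin//; first exact/measurable_EFinP.
  by move=> y _; rewrite lee_fin.
under eq_integral do rewrite FE.
rewrite ge0_integralZr//; first exact/measurable_EFinP.
- by move=> x _; rewrite lee_fin.
- by apply: integral_ge0 => y _; rewrite lee_fin.
Qed.

Lemma exists_borel_product : exists P : probability (borelType (X * X)%type) R,
  forall f g : X -> R,
  measurable_fun [set: borelType X] (f : borelType X -> R) ->
  measurable_fun [set: borelType X] (g : borelType X -> R) ->
  (forall x, 0 <= f x)%R -> (forall x, 0 <= g x)%R ->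
  \int[P]_z (f z.1 * g z.2)%:E = \int[mu]_x (f x)%:E * \int[nu]_x (g x)%:E.
Proof. by exists P; exact: borel_product_integralM. Qed.

End product_measure.
End borel_product.

Section discrete_coupling.
Context {R : realType} {I : finType}.

Lemma discrete_coupling (p q : I -> R) :
  (forall i, 0 <= p i)%R -> (forall i, 0 <= q i)%R ->
  (\sum_i p i = 1)%R -> (\sum_i q i = 1)%R ->
  exists w : I -> I -> R, [/\ forall i j, (0 <= w i j)%R,
    forall i, (\sum_j w i j = p i)%R, forall j, (\sum_i w i j = q j)%R &
    (\sum_i \sum_j (if i == j then 0 else w i j) <= \sum_i `|p i - q i|)%R].
Proof.
move=> p0 q0 p1 q1.
(* The common mass stays on the diagonal, the excesses are coupled independently.
   If [r = 0], both excesses vanish and the quotient by [r] is [0]. *)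
pose c i := Num.min (p i) (q i).
have cp i : (c i <= p i)%R by rewrite ge_min lexx.
have cq i : (c i <= q i)%R by rewrite ge_min lexx orbT.
pose r : R := (1 - \sum_i c i)%R.
have rp : (\sum_i (p i - c i) = r)%R by rewrite sumrB p1.
have rq : (\sum_i (q i - c i) = r)%R by rewrite sumrB q1.
have r0 : (0 <= r)%R by rewrite -rp sumr_ge0// => i _; rewrite subr_ge0.
have pr i : ((p i - c i) * r / r = p i - c i)%R.
  have [re0|rn0] := eqVneq r 0%R; last by rewrite mulfK.
  rewrite re0 mulr0 mul0r; apply/esym.
  by apply: (psumr_eq0P _ (etrans rp re0)) => // j _; rewrite subr_ge0.
have qr i : (r * (q i - c i) / r = q i - c i)%R.
  have [re0|rn0] := eqVneq r 0%R; last by rewrite mulrC mulKf.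
  rewrite re0 !mul0r; apply/esym.
  by apply: (psumr_eq0P _ (etrans rq re0)) => // j _; rewrite subr_ge0.
have offge0 i j : (0 <= (p i - c i) * (q j - c j) / r)%R.
  by rewrite divr_ge0// mulr_ge0// subr_ge0.
exists (fun i j => (if i == j then c i else 0) + (p i - c i) * (q j - c j) / r)%R.
split.
- move=> i j; rewrite addr_ge0//; case: ifP => // _.
  by rewrite le_min p0 q0.
- move=> i; rewrite big_split/= -big_mkcond/= (big_pred1 i) => [|j]; last by rewrite eq_sym.
  by rewrite -mulr_suml -mulr_sumr rq pr addrC subrK.
- move=> j; rewrite big_split/= -big_mkcond/= big_pred1_eq.
  by rewrite -mulr_suml -mulr_suml rp qr addrC subrK.
- apply: (@le_trans _ _ (\sum_i \sum_j (p i - c i) * (q j - c j) / r)%R).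
    by apply: ler_sum => i _; apply: ler_sum => j _; rewrite /=;
      case: (i == j); rewrite ?add0r ?offge0.
  under eq_bigr => i _ do rewrite -mulr_suml -mulr_sumr rq pr.
  apply: ler_sum => i _; rewrite /c.
  by case: (leP (p i) (q i)) => _; rewrite ?subrr// ler_norm.
Qed.

End discrete_coupling.

Section partition_coupling.
Context {R : realType} {X : pmetricType R} {I : finType}.
Variables (mu nu : probability (borelType X) R) (psi phi : I -> X -> R).
Hypotheses (nur : radon nu)
  (mpsi : forall i, measurable_fun [set: borelType X] (psi i : borelType X -> R))
  (mphi : forall i, measurable_fun [set: borelType X] (phi i : borelType X -> R))
  (psi0 : forall i x, (0 <= psi i x)%R) (phi0 : forall i x, (0 <= phi i x)%R)
  (psi1 : forall x, (\sum_i psi i x = 1)%R) (phi1 : forall x, (\sum_i phi i x = 1)%R).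

Let p i : R := fine (\int[mu]_x (psi i x)%:E).
Let q i : R := fine (\int[nu]_x (phi i x)%:E).

(** Taken with [A = setT] for the total masses [p] and [q], and with arbitrary [A] for the marginals
    of the competitor. *)
Lemma partition_integral (P : probability (borelType X) R) (f : I -> X -> R)
    (A : set (borelType X)) :
  measurable A ->
  (forall i, measurable_fun [set: borelType X] (f i : borelType X -> R)) ->
  (forall i x, (0 <= f i x)%R) -> (forall x, (\sum_i f i x = 1)%R) ->
  exists s : I -> R, [/\ forall i, \int[P]_x (\1_A x * f i x)%:E = (s i)%:E,
    forall i, (0 <= s i <= fine (\int[P]_x (f i x)%:E))%R & (\sum_i s i)%:E = P A].
Proof.
move=> mA mf f0 f1.
have fle1 i x : (0 <= f i x <= 1)%R.
  by rewrite f0/= -(f1 x) (bigD1 i)//= lerDl sumr_ge0.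
have mAf i : measurable_fun [set: borelType X] (fun x : borelType X => \1_A x * f i x)%R.
  by apply: measurable_funM => //; exact: measurable_indic.
have Af0 i x : (0 <= \1_A x * f i x)%R by rewrite mulr_ge0.
have Afle i x : (\1_A x * f i x <= f i x)%R.
  by rewrite ler_piMl// indicE; case: (x \in A).
have Af01 i x : (0 <= \1_A x * f i x <= 1)%R.
  by rewrite Af0 (le_trans (Afle i x))//; have /andP[] := fle1 i x.
have sE i := fineK (integral01_fin_num P (mAf i) (Af01 i)).
exists (fun i => fine (\int[P]_x (\1_A x * f i x)%:E)); split => [i|i|].
- by rewrite sE.
- rewrite -!lee_fin sE (fineK (integral01_fin_num P (mf i) (fle1 i))).
  rewrite integral_ge0/=; last by move=> x _; rewrite lee_fin.
  apply: ge0_le_integral => //.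
  + by move=> x _; rewrite lee_fin.
  + exact/measurable_EFinP.
  + exact/measurable_EFinP.
  + by move=> x _; rewrite lee_fin.
- rewrite -sumEFin; under eq_bigr do rewrite sE.
  rewrite -ge0_integral_sum//; last 2 first.
  + by move=> i; exact/measurable_EFinP.
  + by move=> i x _; rewrite lee_fin.
  under eq_integral do rewrite sumEFin -mulr_sumr f1 mulr1.
  by rewrite integral_indic// setIT.
Qed.

(** The factors carry both indices because the cost estimate uses [psi i * E i j], where [E i j]
    distinguishes the diagonal. *)
Lemma borel_product_integral_sum (P : probability (borelType (X * X)%type) R)
    (t : I -> I -> R) (f g : I -> I -> X -> R) :
  (forall f g : X -> R,
    measurable_fun [set: borelType X] (f : borelType X -> R) ->
    measurable_fun [set: borelType X] (g : borelType X -> R) ->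
    (forall x, 0 <= f x)%R -> (forall x, 0 <= g x)%R ->
    \int[P]_z (f z.1 * g z.2)%:E = \int[mu]_x (f x)%:E * \int[nu]_x (g x)%:E) ->
  (forall i j, 0 <= t i j)%R ->
  (forall i j, measurable_fun [set: borelType X] (f i j : borelType X -> R)) ->
  (forall i j, measurable_fun [set: borelType X] (g i j : borelType X -> R)) ->
  (forall i j x, 0 <= f i j x)%R -> (forall i j x, 0 <= g i j x)%R ->
  measurable_fun [set: borelType (X * X)%type]
    (fun z : borelType (X * X)%type => \sum_i \sum_j t i j * (f i j z.1 * g i j z.2))%R /\
  \int[P]_z (\sum_i \sum_j t i j * (f i j z.1 * g i j z.2))%:E =
  \sum_i \sum_j (t i j)%:E * (\int[mu]_x (f i j x)%:E * \int[nu]_x (g i j x)%:E).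
Proof.
move=> PE t0 mf mg f0 g0.
have mfg i j : measurable_fun [set: borelType (X * X)%type]
    (fun z : borelType (X * X)%type => f i j z.1 * g i j z.2)%R.
  apply: measurable_funM.
    by apply: (measurableT_comp (mf i j)); exact: fst_borel.
  by apply: (measurableT_comp (mg i j)); exact: snd_borel.
have fg0 i j (z : X * X) : (0 <= f i j z.1 * g i j z.2)%R by rewrite mulr_ge0.
have mtfg i j : measurable_fun [set: borelType (X * X)%type]
    (fun z : borelType (X * X)%type => t i j * (f i j z.1 * g i j z.2))%R.
  exact: measurable_funM.
have msum i : measurable_fun [set: borelType (X * X)%type]
    (fun z : borelType (X * X)%type => \sum_j t i j * (f i j z.1 * g i j z.2))%R.
  exact: measurable_sum.
split; first exact: measurable_sum.
under eq_integral do rewrite -sumEFin.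
rewrite ge0_integral_sum//; last 2 first.
- by move=> i; exact/measurable_EFinP.
- by move=> i z _; rewrite lee_fin sumr_ge0// => j _; rewrite mulr_ge0.
apply: eq_bigr => i _.
under eq_integral do rewrite -sumEFin.
rewrite ge0_integral_sum//; last 2 first.
- by move=> j; exact/measurable_EFinP.
- by move=> j z _; rewrite lee_fin mulr_ge0.
apply: eq_bigr => j _.
under eq_integral do rewrite EFinM.
rewrite ge0_integralZl_EFin//; [by rewrite PE|by move=> z _; rewrite lee_fin|].
exact/measurable_EFinP.
Qed.

(** The marginals are exact because both partitions sum to 1 and [w] couples [p] with [q]. In the
    cost, the diagonal terms are governed by the hypothesis on [f], and the off-diagonal mass, at
    most the sum of the [|p i - q i|], by the bound [M]. The functions [k1] and [k2] leave room for
    errors, such as those outside a compact set. *)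
Lemma partition_coupling :
  exists pi : probability (borelType (X * X)%type) R, coupling mu nu pi /\
  forall (f : X * X -> R) (G : I -> X -> R) (k1 k2 : X -> R) (M : R),
  measurable_fun [set: borelType (X * X)%type] (f : borelType (X * X)%type -> R) ->
  (forall i, measurable_fun [set: borelType X] (G i : borelType X -> R)) ->
  measurable_fun [set: borelType X] (k1 : borelType X -> R) ->
  measurable_fun [set: borelType X] (k2 : borelType X -> R) ->
  (forall z, 0 <= f z <= M)%R -> (forall i x, 0 <= G i x)%R ->
  (forall x, 0 <= k1 x)%R -> (forall x, 0 <= k2 x)%R ->
  (forall i x y, 0 < psi i x -> 0 < phi i y -> f (x, y) <= G i x + k1 x + k2 y)%R ->
  \int[pi]_z (f z)%:E <= \sum_i \int[mu]_x (psi i x * G i x)%:E +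
    \int[mu]_x (k1 x)%:E + \int[nu]_x (k2 x)%:E + (M * \sum_i `|p i - q i|)%:E.
Proof.
have [P PE] := exists_borel_product mu nur.
have [sp [spE sp0 sp1]] := partition_integral mu measurableT mpsi psi0 psi1.
have [sq [sqE sq0 sq1]] := partition_integral nu measurableT mphi phi0 phi1.
have pE i : \int[mu]_x (psi i x)%:E = (p i)%:E.
  by rewrite /p; have := spE i; under eq_integral do rewrite indicT mul1r; move=> ->.
have qE i : \int[nu]_x (phi i x)%:E = (q i)%:E.
  by rewrite /q; have := sqE i; under eq_integral do rewrite indicT mul1r; move=> ->.
have p0 i : (0 <= p i)%R by have /andP[/le_trans] := sp0 i; apply.
have q0 i : (0 <= q i)%R by have /andP[/le_trans] := sq0 i; apply.
have p1 : (\sum_i p i = 1)%R.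
  apply: EFin_inj; rewrite -(probability_setT mu) -sp1; congr EFin.
  apply: eq_bigr => i _; apply: EFin_inj; rewrite -spE -pE.
  by under [RHS]eq_integral do rewrite indicT mul1r.
have q1 : (\sum_i q i = 1)%R.
  apply: EFin_inj; rewrite -(probability_setT nu) -sq1; congr EFin.
  apply: eq_bigr => i _; apply: EFin_inj; rewrite -sqE -qE.
  by under [RHS]eq_integral do rewrite indicT mul1r.
have [w [w0 wp wq woff]] := discrete_coupling p0 q0 p1 q1.
have wp0 i j : p i = 0%R -> w i j = 0%R.
  by move=> pi0; apply: (psumr_eq0P _ (etrans (wp i) pi0)).
have wq0 i j : q j = 0%R -> w i j = 0%R.
  by move=> qj0; apply: (psumr_eq0P _ (etrans (wq j) qj0)).
(* If [p i] or [q j] is 0, so is [w i j], and the quotient, then 0 by convention, still satisfies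
   [tw]. *)
pose t i j : R := (w i j / (p i * q j))%R.
have t0 i j : (0 <= t i j)%R by rewrite divr_ge0// mulr_ge0.
have tw i j : (t i j * (p i * q j) = w i j)%R.
  have [pq0|pqn0] := eqVneq (p i * q j)%R 0%R; last by rewrite divfK.
  rewrite pq0 mulr0; apply/esym; move/eqP : pq0.
  by rewrite mulf_eq0 => /orP[] /eqP; [exact: wp0|exact: wq0].
have tp0 i j : p i = 0%R -> t i j = 0%R by move=> pi0; rewrite /t wp0// mul0r.
clearbody t.
(* For [p i > 0] the sum of [t i j * q j] over [j] is 1, and [s i <= p i] removes the other indices.
   With [s i] the integral of [psi i] over [A], this gives the first marginal. *)
have sum_t1 (s : I -> R) : (forall i, 0 <= s i <= p i)%R ->
    (\sum_i \sum_j t i j * (s i * q j) = \sum_i s i)%R.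
  move=> s0; apply: eq_bigr => i _.
  have [pi0|pin0] := eqVneq (p i) 0%R.
    have -> : s i = 0%R by apply/eqP; rewrite eq_le -{1}pi0 andbC s0.
    by apply: big1 => j _; rewrite mul0r mulr0.
  transitivity (\sum_j (s i / p i) * w i j)%R.
    by apply: eq_bigr => j _; rewrite -tw; field.
  by rewrite -mulr_sumr wp divfK.
have sum_t2 (s : I -> R) : (forall i, 0 <= s i <= q i)%R ->
    (\sum_i \sum_j t i j * (p i * s j) = \sum_i s i)%R.
  move=> s0; rewrite exchange_big/=; apply: eq_bigr => j _.
  have [qj0|qjn0] := eqVneq (q j) 0%R.
    have -> : s j = 0%R by apply/eqP; rewrite eq_le -{1}qj0 andbC s0.
    by apply: big1 => i _; rewrite !mulr0.
  transitivity (\sum_i (s j / q j) * w i j)%R.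
    by apply: eq_bigr => i _; rewrite -tw; field.
  by rewrite -mulr_sumr wq divfK.
pose g (z : borelType (X * X)%type) : R :=
  (\sum_i \sum_j t i j * (psi i z.1 * phi j z.2))%R.
have PS := borel_product_integral_sum PE t0.
have [mg0 gint] := PS (fun i j => psi i) (fun i j => phi j)
  (fun i j => mpsi i) (fun i j => mphi j) (fun i j => psi0 i) (fun i j => phi0 j).
have g0 z : (0 <= g z)%R.
  by apply: sumr_ge0 => i _; apply: sumr_ge0 => j _; rewrite !mulr_ge0.
have g1 : \int[P]_z (g z)%:E = 1.
  rewrite gint; under eq_bigr do under eq_bigr do rewrite pE qE -!EFinM.
  under eq_bigr do rewrite sumEFin.
  by rewrite sumEFin sum_t1 ?p1// => i; rewrite p0 lexx.
have mg : measurable_fun setT g by exact: mg0.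
have [pi piE] := exists_density mg g0 g1.
have cpi : coupling mu nu pi.
  move=> A mA; split.
    have [s [sE s0 s1]] := partition_integral mu mA mpsi psi0 psi1.
    have mA1 := preimage_fst_borel mA.
    have [_] := PS (fun i _ x => \1_A x * psi i x)%R (fun _ j => phi j)
      (fun i _ => measurable_funM (measurable_indic mA) (mpsi i))
      (fun _ j => mphi j)
      (fun i _ x => mulr_ge0 (ler0n _ _) (psi0 i x)) (fun _ j => phi0 j).
    under [in RHS]eq_bigr do under eq_bigr do rewrite sE qE -!EFinM.
    under [in RHS]eq_bigr do rewrite sumEFin.
    rewrite sumEFin sum_t1// s1 => <-.
    rewrite -[LHS]/(pi (fst @^-1` A)) -[fst @^-1` A]setIT -integral_indic//.
    rewrite piE//.
    apply: eq_integral => z _; congr EFin; rewrite /g mulr_sumr.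
    apply: eq_bigr => i _; rewrite mulr_sumr; apply: eq_bigr => j _.
    by rewrite /= -!mulrA mulrCA.
  have [s [sE s0 s1]] := partition_integral nu mA mphi phi0 phi1.
  have mA2 := preimage_snd_borel mA.
  have [_] := PS (fun i _ => psi i) (fun _ j x => \1_A x * phi j x)%R
    (fun i _ => mpsi i)
    (fun _ j => measurable_funM (measurable_indic mA) (mphi j))
    (fun i _ => psi0 i) (fun _ j x => mulr_ge0 (ler0n _ _) (phi0 j x)).
  under [in RHS]eq_bigr do under eq_bigr do rewrite sE pE -!EFinM.
  under [in RHS]eq_bigr do rewrite sumEFin.
  rewrite sumEFin sum_t2// s1 => <-.
  rewrite -[LHS]/(pi (snd @^-1` A)) -[snd @^-1` A]setIT -integral_indic//.
  rewrite piE//.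
  apply: eq_integral => z _; congr EFin; rewrite /g mulr_sumr.
  apply: eq_bigr => i _; rewrite mulr_sumr; apply: eq_bigr => j _.
  by rewrite /= mulrCA (mulrCA _ (psi i z.1)).
exists pi; split => // f G k1 k2 M mf mG mk1 mk2 f0M G0 k10 k20 fG.
have f0 z : (0 <= f z)%R by have /andP[] := f0M z.
have fM z : (f z <= M)%R by have /andP[] := f0M z.
have M0 : (0 <= M)%R by have /andP[/le_trans] := f0M (point, point); apply.
(* Pointwise, [f * g] is bounded by replacing [f] in the [(i, j)] term by [E i j + k]. *)
pose E i j (x : X) : R := if i == j then G i x else M.
have mE i j : measurable_fun [set: borelType X] (E i j : borelType X -> R).
  by rewrite /E; case: (i == j) => //; exact: measurable_cst.
have E0 i j x : (0 <= E i j x)%R by rewrite /E; case: (i == j).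
have [mH Hint] := PS (fun i j x => psi i x * E i j x)%R (fun _ j => phi j)
  (fun i j => measurable_funM (mpsi i) (mE i j)) (fun _ j => mphi j)
  (fun i j x => mulr_ge0 (psi0 i x) (E0 i j x)) (fun _ j => phi0 j).
set H := (fun z : borelType (X * X)%type => \sum_i _)%R in mH Hint.
have H0 z : (0 <= H z)%R.
  by apply: sumr_ge0 => i _; apply: sumr_ge0 => j _; rewrite !mulr_ge0.
pose k (z : borelType (X * X)%type) : R := (k1 z.1 + k2 z.2)%R.
have mk : measurable_fun setT k.
  apply: measurable_funD.
    by apply: (measurableT_comp mk1); exact: fst_borel.
  by apply: (measurableT_comp mk2); exact: snd_borel.
have k0 z : (0 <= k z)%R by rewrite addr_ge0.
have kint : \int[P]_z (k z * g z)%:E = \int[mu]_x (k1 x)%:E + \int[nu]_x (k2 x)%:E.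
  rewrite -piE//; under eq_integral do rewrite EFinD.
  rewrite ge0_integralD//; last 4 first.
  - by move=> z _; rewrite lee_fin.
  - by apply/measurable_EFinP; apply: (measurableT_comp mk1); exact: fst_borel.
  - by move=> z _; rewrite lee_fin.
  - by apply/measurable_EFinP; apply: (measurableT_comp mk2); exact: snd_borel.
  rewrite (coupling_integral_fst (f := EFin \o k1) cpi)//; last exact/measurable_EFinP.
  by rewrite (coupling_integral_snd (f := EFin \o k2) cpi)//; exact/measurable_EFinP.
have fgle z : (f z * g z <= H z + k z * g z)%R.
  rewrite /H /g !mulr_sumr -big_split/=; apply: ler_sum => i _.
  rewrite !mulr_sumr -big_split/=; apply: ler_sum => j _.
  have -> : (f z * (t i j * (psi i z.1 * phi j z.2)) =
    t i j * (psi i z.1 * phi j z.2) * f z)%R by ring.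
  have -> : (t i j * (psi i z.1 * E i j z.1 * phi j z.2) +
      k z * (t i j * (psi i z.1 * phi j z.2)) =
    t i j * (psi i z.1 * phi j z.2) * (E i j z.1 + k z))%R by ring.
  have := psi0 i z.1; rewrite le_eqVlt => /predU1P[<-|psip].
    by rewrite mul0r mulr0 !mul0r.
  have := phi0 j z.2; rewrite le_eqVlt => /predU1P[<-|phip].
    by rewrite !mulr0 !mul0r.
  apply: ler_wpM2l; first by rewrite !mulr_ge0.
  rewrite /E; case: eqP => [ij|_]; last by rewrite (le_trans (fM z))// lerDl.
  by rewrite /k addrA; case: z psip phip => x y /= psip phip; apply: fG => //; rewrite ij.
rewrite piE//; apply: (@le_trans _ _ (\int[P]_z (H z + k z * g z)%:E)).
  apply: ge0_le_integral => //.
  - by move=> z _; rewrite lee_fin mulr_ge0.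
  - by apply/measurable_EFinP; exact: measurable_funM.
  - by apply/measurable_EFinP; apply: measurable_funD => //; exact: measurable_funM.
  - by move=> z _; rewrite lee_fin.
under eq_integral do rewrite EFinD.
rewrite ge0_integralD//; last 4 first.
- by move=> z _; rewrite lee_fin.
- exact/measurable_EFinP.
- by move=> z _; rewrite lee_fin mulr_ge0.
- by apply/measurable_EFinP; exact: measurable_funM.
rewrite kint Hint -[X in _ <= X + _]addeA [leRHS]addeAC leeD2r//.
(* Indeed [t i i * q i * p i = w i i <= p i]. So each diagonal term is at most the integral of
   [psi i * G i]. *)
have tiq i : (t i i * q i <= 1)%R.
  have := p0 i; rewrite le_eqVlt => /predU1P[/esym pi0|pi0].
    by rewrite tp0// mul0r.
  rewrite -(ler_pM2r pi0) mul1r -mulrA [(q i * _)%R]mulrC tw -wp.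
  by rewrite (bigD1 i)//= lerDl sumr_ge0.
pose T i : \bar R := \int[mu]_x (psi i x * G i x)%:E.
have T0 i : 0 <= T i by apply: integral_ge0 => x _; rewrite lee_fin mulr_ge0.
have term i j : (t i j)%:E * (\int[mu]_x (psi i x * E i j x)%:E * \int[nu]_x (phi j x)%:E) <=
    (if i == j then T i else 0) + (M * (if i == j then 0 else w i j))%:E.
  rewrite qE /E; case: eqP => [<-|_]; rewrite ?mulr0 ?adde0 ?add0e.
    rewrite (muleC (\int[mu]_x _)) muleA -EFinM -[leRHS]mul1e.
    by apply: lee_wpmul2r; [exact: T0|rewrite lee_fin].
  under eq_integral do rewrite mulrC EFinM.
  rewrite ge0_integralZl_EFin//; [|by move=> x _; rewrite lee_fin|exact/measurable_EFinP].
  by rewrite pE -!EFinM lee_fin -tw le_eqVlt; apply/orP; left; apply/eqP; ring.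
apply: (@le_trans _ _ (\sum_i \sum_j
    ((if i == j then T i else 0) + (M * (if i == j then 0 else w i j))%:E))).
  by apply: lee_sum => i _; apply: lee_sum => j _; exact: term.
under eq_bigr => i _ do rewrite big_split/= sumEFin -mulr_sumr.
rewrite big_split/= sumEFin -mulr_sumr; apply: leeD.
  apply: lee_sum => i _; rewrite -big_mkcond/= (big_pred1 i)//.
by rewrite lee_fin ler_wpM2l.
Qed.

End partition_coupling.

Section integral_estimates.
Context d (T : measurableType d) {R : realType}.

Lemma integral_cst_indic (P : probability T R) (e M : R) (A : set T) :
  (0 <= e)%R -> (0 <= M)%R -> measurable A ->
  \int[P]_x (e + M * \1_A x)%:E = e%:E + M%:E * P A.
Proof.
move=> e0 M0 mA; under eq_integral do rewrite EFinD EFinM.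
rewrite ge0_integralD//; last 2 first.
- by move=> x _; rewrite -EFinM lee_fin mulr_ge0.
- by apply: emeasurable_funM => //; apply/measurable_EFinP; exact: measurable_indic.
rewrite integral_cst// ge0_integralZl_EFin//; last first.
  by apply/measurable_EFinP; exact: measurable_indic.
by rewrite integral_indic// setIT [X in _ * X + _]probability_setT mule1.
Qed.

Lemma integral_le_approx (P : probability T R) (f g : T -> R) (e M : R) (A : set T) :
  measurable_fun setT f -> measurable_fun setT g -> measurable A ->
  (forall x, 0 <= f x)%R -> (forall x, 0 <= g x)%R -> (0 <= e)%R -> (0 <= M)%R ->
  (forall x, ~ A x -> f x <= g x + e)%R -> (forall x, A x -> f x <= M)%R ->
  \int[P]_x (f x)%:E <= \int[P]_x (g x)%:E + e%:E + M%:E * P A.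
Proof.
move=> mf mg mA f0 g0 e0 M0 fg fM.
rewrite -addeA -integral_cst_indic// -ge0_integralD//; last 4 first.
- by move=> x _; rewrite lee_fin.
- exact/measurable_EFinP.
- by move=> x _; rewrite lee_fin addr_ge0// mulr_ge0.
- apply/measurable_EFinP; apply: measurable_funD => //.
  by apply: measurable_funM => //; exact: measurable_indic.
apply: ge0_le_integral => //.
- by move=> x _; rewrite lee_fin.
- exact/measurable_EFinP.
- apply: emeasurable_funD; apply/measurable_EFinP => //.
  apply: measurable_funD => //.
  by apply: measurable_funM => //; exact: measurable_indic.
- move=> x _; rewrite -EFinD lee_fin indicE.
  case: (boolP (x \in A)) => [/set_mem Ax|]; last first.
    by rewrite notin_setE mulr0 addr0 => /fg.
  by rewrite mulr1 (le_trans (fM _ Ax))// addrA lerDr addr_ge0.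
Qed.

End integral_estimates.

Section compact_sets.
Context {R : realType} {X : pmetricType R}.

(** The tight family starts at index 1; for [mu 0] the Radon property supplies the compact set. *)
Lemma exists_common_compact (mu : nat -> probability (borelType X) R) :
  (forall n, radon (mu n)) ->
  uniformly_tight [set mu n | n in [set n | (0 < n)%N]] ->
  forall e : R, (0 < e)%R -> exists K : set X, compact K /\
    forall n, mu n (~` K) < e%:E.
Proof.
move=> mur mut e e0.
have [K1 [cK1 K1e]] := mut e e0.
have [K0 [cK0 _ K0e]] := mur 0%N setT measurableT e e0.
exists (K0 `|` K1); split; first exact: compactU.
have mK0 := compact_borel cK0; have mK1 := compact_borel cK1.
have mK : measurable (~` (K0 `|` K1) : set (borelType X)).
  by apply: measurableC; exact: measurableU.
move=> [|n].
  apply: le_lt_trans K0e; apply: le_measure; rewrite ?inE//; first exact: measurableD.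
  by move=> x /=; move/not_orP => [? _].
apply: le_lt_trans (K1e (mu n.+1) _); last by exists n.+1.
apply: le_measure; rewrite ?inE//; first exact: measurableC.
by move=> x /=; move/not_orP => [_ ?].
Qed.

(** Near each [x] in [K], both [f (x', y)] and [f (x', y0)] are within [e / 2] of [f (x, y0)];
    compactness of [K] makes the neighbourhood of [y0] uniform. *)
Lemma compact_equicontinuity (f : X * X -> R) (K : set X) (y0 : X) (e : R) :
  continuous f -> compact K -> (0 < e)%R ->
  \forall y \near y0, forall x, K x -> (`|f (x, y) - f (x, y0)| < e)%R.
Proof.
move=> cf cK e0.
have /compact_near_coveringP/(_ X (nbhs y0)
  (fun y x => (`|f (x, y) - f (x, y0)| < e)%R) _) := cK; apply.
move=> x _.
have e20 : (0 < e / 2)%R by rewrite divr_gt0.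
have /cvgrPdist_lt/(_ _ e20) := cf (x, y0).
move=> [[A B] /= [Ax By] AB]; exists (A, B) => //= -[x' y] [/= Ax' By'].
have h1 := AB (x', y) (conj Ax' By').
have h2 := AB (x', y0) (conj Ax' (nbhs_singleton By)).
rewrite [e]splitr; apply: le_lt_trans (ltrD h1 h2).
rewrite -[X in (`|X| <= _)%R](subrKA (f (x, y0))).
by rewrite (le_trans (ler_normD _ _))// [X in (X + _ <= _)%R]distrC.
Qed.

(** The functions are those of [closed_zero_set] for the complements of finitely many interiors
    covering [K], divided by their sum. The index [o] stands for the function vanishing exactly on
    [K], which keeps the sum positive off [K]. *)
Lemma partition_of_unity (K : set X) (V : X -> set X) : compact K ->
  (forall y, K y -> nbhs y (V y)) ->
  exists (I : finType) (o : I) (y : I -> X) (phi : I -> X -> R),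
  [/\ forall i, continuous (phi i), forall i x, (0 <= phi i x)%R,
    forall x, (\sum_i phi i x = 1)%R, forall x, K x -> phi o x = 0%R &
    forall i x, i != o -> (0 < phi i x)%R -> V (y i) x].
Proof.
move=> cK KV.
have oV y : K y -> open (interior (V y)) by move=> _; exact: open_interior.
have [D DK KD] : finite_subset_cover K (fun y => interior (V y)) K.
  move: cK; rewrite compact_cover; apply => // y Ky.
  by exists y => //; apply: KV.
pose I : finType := seq_sub (finmap.enum_fset D).
have [u0 [cu0 u00 Ku0]] := closed_zero_set (compact_closed (@metric_hausdorff _ X) cK).
have ex (i : I) : exists u : X -> R, [/\ continuous u, forall x, (0 <= u x)%R &
    ~` interior (V (val i)) = [set x | u x = 0%R]].
  by apply: closed_zero_set; apply: open_closedC; exact: open_interior.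
have [u uP] := choice ex.
pose v (i : option I) := if i is Some j then u j else u0.
have cv i : continuous (v i) by case: i => // i; have [] := uP i.
have v0 i x : (0 <= v i x)%R.
  by case: i => [i|]; [have [_ + _] := uP i; apply|exact: u00].
pose S x := (\sum_i v i x)%R.
have S0 x : (0 < S x)%R.
  have [i vi] : exists i, (0 < v i x)%R.
    have [Kx|nKx] := pselect (K x); last first.
      exists None; rewrite lt_neqAle eq_sym u00 andbT; apply/eqP => u0x.
      by apply: nKx; rewrite Ku0.
    have [y /= yD Vy] := KD _ Kx.
    exists (Some (SeqSub yD : I)).
    rewrite /v; have [_ u_ge0 uE] := uP (SeqSub yD).
    rewrite lt_neqAle eq_sym u_ge0 andbT; apply/eqP => ux.
    suff : (~` interior (V y)) x by apply.
    by have -> : ~` interior (V y) = [set x | u (SeqSub yD) x = 0%R] by exact: uE.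
  by rewrite /S (bigD1 i)//= ltr_pwDl// sumr_ge0.
have cS : continuous S.
  by move=> x; apply: cvg_big => [|i _]; [exact: add_continuous|exact: cv].
(* [point] is a dummy centre for the index [o]. *)
exists (option I), None, (fun i => if i is Some j then val j else point),
  (fun i x => v i x / S x)%R; split.
- move=> i x; apply: continuousM; first exact: cv.
  by apply: continuousV; [rewrite gt_eqF|exact: cS].
- by move=> i x; rewrite divr_ge0// ltW.
- by move=> x; rewrite -mulr_suml -/(S x) divff// gt_eqF.
- by move=> x; rewrite Ku0 /= => ->; rewrite mul0r.
- move=> [i|//] x _; rewrite pmulr_lgt0 ?invr_gt0// => ux.
  apply: interior_subset; apply: contrapT => nV.
  have [_ _ /seteqP[/(_ x nV) /= ux0 _]] := uP i.
  by move: ux; rewrite /v ux0 ltxx.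
Qed.

End compact_sets.

Section plan_approximation.
Context {R : realType} {X : pmetricType R}.
Variables (mu nu : nat -> probability (borelType X) R)
  (sigma : probability (borelType (X * X)%type) R) (T : X -> X).
Hypotheses
  (nu_radon : forall n, radon (nu n))
  (mu_cvg : cvg_in_variation mu (mu 0%N))
  (nu_cvg : cvg_weakly nu (nu 0%N))
  (tight : forall e : R, (0 < e)%R -> exists K : set X, compact K /\
    forall n, mu n (~` K) < e%:E /\ nu n (~` K) < e%:E)
  (c0 : coupling (mu 0%N) (nu 0%N) sigma)
  (T_transport : transport_map (mu 0%N) (nu 0%N) T)
  (sigma_T : generated_by (mu 0%N) T sigma).

Lemma transport_integral (f : X -> R) :
  measurable_fun [set: borelType X] (f : borelType X -> R) ->
  (forall x, 0 <= f x)%R ->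
  \int[mu 0%N]_x (f (T x))%:E = \int[nu 0%N]_x (f x)%:E.
Proof.
move=> mf f0; have [mT nuT] := T_transport.
pose T_mixin := isMeasurableFun.Build _ _ _ _ (T : borelType X -> borelType X) mT.
pose T' : {mfun borelType X >-> borelType X} :=
  HB.pack (T : borelType X -> borelType X) T_mixin.
transitivity (\int[pushforward (mu 0%N) T']_x (f x)%:E).
  rewrite ge0_integral_pushforward//; first exact/measurable_EFinP.
  by move=> x _; rewrite lee_fin.
by apply: eq_measure_integral => A mA _; exact: nuT.
Qed.

Lemma integral_variation_near (f : X -> R) (M : R) :
  measurable_fun [set: borelType X] (f : borelType X -> R) ->
  (forall x, 0 <= f x <= M)%R -> forall e : R, (0 < e)%R ->
  \forall n \near \oo,
    \int[mu n]_x (f x)%:E <= \int[mu 0%N]_x (f x)%:E + e%:E /\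
    \int[mu 0%N]_x (f x)%:E <= \int[mu n]_x (f x)%:E + e%:E.
Proof.
move=> mf f0M e e0.
have mfa (t : R) : measurable ([set x | (t < f x)%R] : set (borelType X)).
  rewrite (_ : [set x | _] = f @^-1` `]t, +oo[%classic).
    by rewrite -[X in measurable X]setTI; exact: mf.
  by apply/seteqP; split => x /=; rewrite in_itv/= andbT.
apply: filterI.
  apply: (integral_le_near (F := \oo) (P := mu) (Q := fun=> mu 0%N) mf f0M) => // t d d0.
  by apply: filterS (cvg_in_variation_near mu_cvg d0) => n /(_ _ (mfa t))[].
apply: (integral_le_near (F := \oo) (P := fun=> mu 0%N) (Q := mu) mf f0M) => // t d d0.
by apply: filterS (cvg_in_variation_near mu_cvg d0) => n /(_ _ (mfa t))[].
Qed.

(** The function [F], the sum of the [psi i x * f (x, y i)], depends on [x] alone, so convergence in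
    variation applies to it. Its integral under [mu 0] is close to the cost of [sigma] because
    [sigma] lives where [y = T x], and its integral under [mu n] bounds the cost of the coupling
    built from the two partitions. *)
Lemma plan_approximation (f : X * X -> R) (M : R) :
  continuous f -> (forall z, 0 <= f z <= M)%R -> forall e : R, (0 < e)%R ->
  \forall n \near \oo, exists pi : probability (borelType (X * X)%type) R,
    coupling (mu n) (nu n) pi /\
    \int[pi]_z (f z)%:E <= \int[sigma]_z (f z)%:E + e%:E.
Proof.
move=> cf f0M e e0.
have f0 z : (0 <= f z)%R by have /andP[] := f0M z.
have fM z : (f z <= M)%R by have /andP[] := f0M z.
have M0 : (0 <= M)%R := le_trans (f0 (point, point)) (fM _).
(* Three parts go into [Fsigma], one into passing from [mu 0] to [mu n], two into [k1], one into
   [k2] and one into the off-diagonal mass. *)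
pose e' : R := (e / 8)%R.
have e'0 : (0 < e')%R by rewrite divr_gt0.
pose eta : R := (e' / (M + 1))%R.
have eta0 : (0 < eta)%R by rewrite divr_gt0// ltr_wpDl.
have Meta : (M * eta <= e')%R.
  rewrite /eta mulrA ler_pdivrMr ?ltr_wpDl// mulrC.
  by apply: ler_wpM2l; [exact: ltW|rewrite lerDl].
have [K [cK Keta]] := tight eta0.
have mK := compact_borel cK.
have mKC : measurable (~` K : set (borelType X)) by exact: measurableC.
have mf := continuous_borel_real cf.
have [J [i0 [y [phi [cphi phi0 phi1 phiK phiV]]]]] := partition_of_unity
  (V := fun y0 => [set y | forall x, K x -> (`|f (x, y) - f (x, y0)| < e')%R]) cK
  (fun y0 _ => compact_equicontinuity y0 cf cK e'0).
have mphi i := continuous_borel_real (cphi i).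
have [mT nuT] := T_transport.
pose psi i x := phi i (T x).
have mpsi i : measurable_fun [set: borelType X] (psi i : borelType X -> R).
  exact: (measurableT_comp (mphi i) mT).
have psi0 i x : (0 <= psi i x)%R by exact: phi0.
have psi1 x : (\sum_i psi i x = 1)%R by exact: phi1.
have phile1 i x : (0 <= phi i x <= 1)%R.
  by rewrite phi0/= -(phi1 x) (bigD1 i)//= lerDl sumr_ge0.
pose G i x := f (x, y i).
have mG i : measurable_fun [set: borelType X] (G i : borelType X -> R).
  apply: continuous_borel_real => x; apply: (continuous_comp (f := fun x => (x, y i))).
    by apply: cvg_pair => //; exact: cvg_cst.
  exact: cf.
pose F x := (\sum_i psi i x * G i x)%R.
have mF : measurable_fun [set: borelType X] (F : borelType X -> R).
  by apply: measurable_sum => i; exact: measurable_funM.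
have F0M x : (0 <= F x <= M)%R.
  apply/andP; split; first by apply: sumr_ge0 => i _; rewrite mulr_ge0// f0.
  rewrite -[leRHS]mul1r -(psi1 x) mulr_suml; apply: ler_sum => i _.
  by rewrite ler_wpM2l// fM.
have FmuE n : \sum_i \int[mu n]_x (psi i x * G i x)%:E = \int[mu n]_x (F x)%:E.
  rewrite -ge0_integral_sum//.
  - by apply: eq_integral => x _; rewrite sumEFin.
  - by move=> i; apply/measurable_EFinP; exact: measurable_funM.
  - by move=> i x _; rewrite lee_fin mulr_ge0// f0.
have Fsigma : \int[mu 0%N]_x (F x)%:E <= \int[sigma]_z (f z)%:E + e'%:E + (2 * e')%:E.
  have mF1 : measurable_fun [set: borelType (X * X)%type]
      (fun z : borelType (X * X)%type => F z.1).
    by apply: (measurableT_comp mF); exact: fst_borel.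
  rewrite -(coupling_integral_fst (f := EFin \o F) c0); last 2 first.
  - exact/measurable_EFinP.
  - by move=> x; rewrite lee_fin; have /andP[] := F0M x.
  (* The Borel set [D = 0] stands in for the graph of [T], which it contains: there
     [phi i y = psi i x] for all [i], which is all that the comparison of [F] with [f] uses. *)
  pose D (z : borelType (X * X)%type) : R := (\sum_i `|phi i z.2 - psi i z.1|)%R.
  have mD : measurable_fun setT D.
    apply: measurable_sum => i; apply: measurableT_comp => //.
    apply: measurable_funB.
      by apply: (measurableT_comp (mphi i)); exact: snd_borel.
    by apply: (measurableT_comp (mpsi i)); exact: fst_borel.
  pose N := ~` (D @^-1` [set 0%R]).
  have mN : measurable N.
    by apply: measurableC; rewrite -[X in measurable X]setTI; exact: mD.
  have N0 : sigma N = 0.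
    rewrite sigma_T// (_ : [set x | _] = set0).
      by rewrite measurable_mu_extE// measure0.
    apply/seteqP; split => // x; apply => /=; apply: big1 => i _.
    by rewrite /= subrr normr0.
  have DE z : ~ N z -> forall i, phi i z.2 = psi i z.1.
    move=> /contrapT /= Dz i; apply/eqP; rewrite -subr_eq0 -normr_eq0.
    by apply/eqP; apply: (psumr_eq0P _ Dz).
  have mKK := setX_borel mK mK.
  have mA : measurable (~` (K `*` K) `|` N : set (borelType (X * X)%type)).
    by apply: measurableU => //; exact: measurableC.
  apply: (@le_trans _ _ (\int[sigma]_z (f z)%:E + e'%:E +
      M%:E * sigma (~` (K `*` K) `|` N))).
    apply: (@integral_le_approx _ _ R sigma (fun z => F z.1) f e' M) => //.
    - by move=> z; have /andP[] := F0M z.1.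
    - exact: ltW.
    - move=> -[x y'] /not_orP[/contrapT [/= Kx Ky'] /DE /= phiE].
      rewrite -[leRHS]mul1r -(psi1 x) mulr_suml; apply: ler_sum => i _.
      have := psi0 i x; rewrite le_eqVlt => /predU1P[<-|psip].
        by rewrite !mul0r.
      rewrite ler_pM2l//; rewrite -phiE in psip.
      have ii0 : i != i0.
        by apply/eqP => ii0; move: psip; rewrite ii0 phiK// ltxx.
      have := phiV i y' ii0 psip x Kx; rewrite ltr_norml /G => /andP[]; lra.
    - by move=> z _; have /andP[] := F0M z.1.
  apply: leeD2l; apply: (@le_trans _ _ (M%:E * (eta + eta)%:E)).
    rewrite lee_wpmul2l ?lee_fin//; apply: (le_trans (measureU2 _ _ mN)).
      exact: measurableC.
    rewrite [X in _ + X]N0 adde0; apply: (le_trans (coupling_setXC c0 mK mK)).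
    by have [? ?] := Keta 0%N; rewrite EFinD leeD// ltW.
  by rewrite -EFinM lee_fin mulrDr mulr2n mulrDl mul1r lerD.
(* Chosen so that the [#|J|] differences of masses add up to at most [eta]. *)
pose d : R := (eta / #|J|.+1%:R)%R.
have d0 : (0 < d)%R by rewrite divr_gt0.
have pq_near : \forall n \near \oo, forall i,
    (`|fine (\int[mu n]_x (psi i x)%:E) - fine (\int[nu n]_x (phi i x)%:E)| <= d)%R.
  apply: filter_forall => i.
  have d20 : (0 < d / 2)%R by rewrite divr_gt0.
  have nui := cvg_weakly_near nu_cvg (cphi i) (phile1 i) d20.
  have mui := integral_variation_near (mpsi i) (fun x => phile1 i (T x)) d20.
  apply: filterS (filterI nui mui) => n /= [+ []].
  (* The masses agree in the limit: [T] carries [mu 0] to [nu 0], so [psi i] has under [mu 0] the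
     integral of [phi i] under [nu 0]. *)
  rewrite (transport_integral (mphi i) (phi0 i)).
  rewrite -(fineK (integral01_fin_num (nu 0%N) (mphi i) (phile1 i))).
  rewrite -(fineK (integral01_fin_num (mu n) (mpsi i) (fun x => phile1 i (T x)))).
  rewrite -!EFinD !lee_fin /= => h1 h2 h3; move: h1.
  rewrite ltr_norml ler_norml; move: h2 h3; clear; move=> h2 h3 /andP[]; lra.
have F_near := integral_variation_near mF F0M e'0.
apply: filterS (filterI pq_near F_near) => n [pqn [Fn _]].
have [pi [cpi piP]] := partition_coupling (mu n) (nu_radon n) mpsi mphi psi0 phi0 psi1 phi1.
exists pi; split => //.
have k0 (c : R) x : (0 <= c)%R -> (0 <= c + M * \1_(~` K) x :> R)%R.
  by move=> c0'; rewrite addr_ge0// mulr_ge0.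
have mk (c : R) : measurable_fun [set: borelType X]
    (fun x : borelType X => c + M * \1_(~` K) x)%R.
  by apply: measurable_funD => //; apply: measurable_funM => //.
(* Off [K] in either variable the term [M] alone dominates [f]; on [K * K] the oscillation bound
   costs [e']. The summand 0 gives both error functions the form required by
   [integral_cst_indic]. *)
have := piP f G (fun x => e' + M * \1_(~` K) x)%R (fun x => 0 + M * \1_(~` K) x)%R M
  mf mG (mk e') (mk 0%R) f0M (fun i x => f0 (x, y i)) (fun x => k0 _ x (ltW e'0))
  (fun x => k0 _ x (lexx _)).
have e'_ge0 := ltW e'0.
rewrite FmuE !integral_cst_indic// => piPn.
apply: (le_trans (piPn _)).
  move=> i x y' _ phip; rewrite add0r.
  have ind0 (z : X) : (0 <= M * \1_(~` K) z :> R)%R by rewrite mulr_ge0.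
  have indM (z : X) : ~ K z -> (M * \1_(~` K) z = M :> R)%R.
    by move=> nKz; rewrite indicE mem_set ?mulr1.
  have Gx : (0 <= G i x)%R by exact: f0.
  have [Kx|/indM ->] := pselect (K x); last first.
    by move: (fM (x, y')) (ind0 y') Gx e'_ge0; clear; lra.
  have [Ky'|/indM ->] := pselect (K y'); last first.
    by move: (fM (x, y')) (ind0 x) Gx e'_ge0; clear; lra.
  have ii0 : i != i0 by apply/eqP => ii0; move: phip; rewrite ii0 phiK// ltxx.
  have := phiV i y' ii0 phip x Kx; rewrite ltr_norml => /andP[_].
  by rewrite -/(G i x); move: (ind0 x) (ind0 y'); clear; lra.
have [muK nuK] := Keta n.
have Mle (P : probability (borelType X) R) : P (~` K) < eta%:E ->
    M%:E * P (~` K) <= e'%:E.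
  move=> PK; apply: (@le_trans _ _ (M%:E * eta%:E)).
    by rewrite lee_wpmul2l ?lee_fin// ltW.
  by rewrite -EFinM lee_fin.
have Msum : (M * \sum_i `|fine (\int[mu n]_x (psi i x)%:E) -
    fine (\int[nu n]_x (phi i x)%:E)| <= e')%R.
  apply: (@le_trans _ _ (M * (d *+ #|J|))%R).
    rewrite ler_wpM2l// -sumr_const; apply: ler_sum => i _; exact: pqn.
  apply: le_trans Meta; apply: ler_wpM2l => //; rewrite -[leLHS]mulr_natr /d.
  by rewrite mulrAC ler_pdivrMr// ler_pM2l// ler_nat.
rewrite add0e.
rewrite -lee_fin in Msum.
apply: (le_trans (leeD (leeD (leeD Fn (leeD2l _ (Mle _ muK))) (Mle _ nuK)) Msum)).
move: Fsigma; move: (\int[mu 0%N]_x (F x)%:E) (\int[sigma]_z (f z)%:E) => A S AS.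
rewrite -!addeA -!EFinD; apply: (le_trans (leeD2r _ AS)).
rewrite -!addeA -!EFinD leeD2l// lee_fin le_eqVlt; apply/orP; left; apply/eqP.
by rewrite /e'; field.
Qed.

End plan_approximation.

(** * Stability of the optimal cost *)

Section cost_stability.
Context {R : realType} {X : pmetricType R}.
Variables (mu nu : nat -> probability (borelType X) R)
  (h : nat -> X * X -> R) (a b : nat -> X -> R)
  (sigma : nat -> probability (borelType (X * X)%type) R).
Hypotheses
  (mu_radon : forall n, radon (mu n))
  (nu_radon : forall n, radon (nu n))
  (mu_cvg : cvg_in_variation mu (mu 0%N))
  (nu_cvg : cvg_weakly nu (nu 0%N))
  (mu_tight : uniformly_tight [set mu n | n in [set n | (0 < n)%N]])
  (nu_tight : uniformly_tight [set nu n | n in [set n | (0 < n)%N]])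
  (h_ge0 : forall n z, (0 <= h n z)%R)
  (h_continuous : forall n, (0 < n)%N -> continuous (h n))
  (h_cvg : {family compact, h @ \oo --> h 0%N})
  (a_ge0 : forall n x, (0 < n)%N -> (0 <= a n x)%R)
  (b_ge0 : forall n x, (0 < n)%N -> (0 <= b n x)%R)
  (a_integrable : forall n, (0 < n)%N ->
    (mu n).-integrable [set: borelType X] (fun x => (a n x)%:E))
  (b_integrable : forall n, (0 < n)%N ->
    (nu n).-integrable [set: borelType X] (fun x => (b n x)%:E))
  (h_le : forall n x y, (0 < n)%N -> (h n (x, y) <= a n x + b n y)%R)
  (ab_unif_integrable :
    ereal_sup [set \int[mu n]_(x in [set x | (a n x >= M)%R]) (a n x)%:E
                   + \int[nu n]_(x in [set x | (b n x >= M)%R]) (b n x)%:E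
              | n in [set n | (0 < n)%N]] @[M --> +oo%R] --> 0)
  (sigma_coupling : forall n, coupling (mu n) (nu n) (sigma n)).

Lemma h_cvg_compact (K : set (X * X)%type) : compact K -> forall e : R, (0 < e)%R ->
  \forall n \near \oo, forall z, K z -> (`|h 0%N z - h n z| < e)%R.
Proof.
move=> cK e e0; move/fam_cvgP : h_cvg => /(_ K cK) hK.
have : nbhs (h 0%N : {uniform` K -> R})
    [set g : {uniform` K -> R} | forall z, K z -> (`|h 0%N z - g z| < e)%R].
  apply/uniform_nbhs; exists [set xy | ball xy.1 e xy.2]; split => //.
  exact: entourage_ball (PosNum e0).
by move=> /hK.
Qed.

(** Since points are compact, [h 0] is a pointwise limit of the continuous functions [h n.+1]. *)
Lemma h_borel n : measurable_fun [set: borelType (X * X)%type]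
  (h n : borelType (X * X)%type -> R).
Proof.
case: n => [|n]; last by apply: continuous_borel_real; exact: h_continuous.
apply: (measurable_fun_cvg (h := fun n => h n.+1 : borelType (X * X)%type -> R)).
  by move=> n; apply: continuous_borel_real; exact: h_continuous.
move=> z _; rewrite (cvg_shiftS (fun n => h n z)); apply/cvgrPdist_lt => e e0.
by apply: filterS (h_cvg_compact (@compact_set1 _ z) e0) => n; exact.
Qed.

Definition trunc n (M : R) (z : X * X) : R := Num.min (h n z) M.

Lemma trunc_ge0 n M z : (0 <= M)%R -> (0 <= trunc n M z)%R.
Proof. by move=> M0; rewrite le_min h_ge0. Qed.

Lemma trunc_le n M z : (trunc n M z <= M)%R.
Proof. by rewrite ge_min lexx orbT. Qed.

Lemma trunc_borel n M : measurable_fun [set: borelType (X * X)%type]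
  (trunc n M : borelType (X * X)%type -> R).
Proof. by apply: measurable_minr => //; [exact: h_borel]. Qed.

Lemma trunc_continuous n M : (0 < n)%N -> continuous (trunc n M).
Proof.
move=> n0 z; apply: (@continuous_min _ _ (h n) (fun=> M)).
  exact: h_continuous.
exact: cst_continuous.
Qed.

Lemma trunc_near n m M z (e : R) : (`|h n z - h m z| <= e)%R ->
  (trunc n M z <= trunc m M z + e)%R.
Proof.
rewrite ler_norml => /andP[h1 h2]; rewrite /trunc.
by case: (leP (h n z) M); case: (leP (h m z) M); lra.
Qed.

Lemma tight_compact (e : R) : (0 < e)%R -> exists K : set X, compact K /\
  forall n, mu n (~` K) < e%:E /\ nu n (~` K) < e%:E.
Proof.
move=> e0; have [K1 [cK1 K1e]] := exists_common_compact mu_radon mu_tight e0.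
have [K2 [cK2 K2e]] := exists_common_compact nu_radon nu_tight e0.
have mK1 := compact_borel cK1; have mK2 := compact_borel cK2.
have mK : measurable (~` (K1 `|` K2) : set (borelType X)).
  by apply: measurableC; exact: measurableU.
exists (K1 `|` K2); split; first exact: compactU.
move=> n; split; [apply: le_lt_trans (K1e n)|apply: le_lt_trans (K2e n)];
  by (apply: le_measure; rewrite ?inE//; [exact: measurableC|
      move=> x /=; move/not_orP => []]).
Qed.

(** The costs [i], [j] and the plan's index [k] are independent, because a fixed cost [h m] is
    compared with others under varying plans. Outside [K * K], of mass at most [d + d], the
    truncated cost is at most [M]. *)
Lemma integral_trunc_near (P : probability (borelType (X * X)%type) R)
    (K : set X) i j k (M e d : R) :
  (0 <= M)%R -> (0 <= e)%R -> compact K ->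
  coupling (mu k) (nu k) P ->
  mu k (~` K) < d%:E -> nu k (~` K) < d%:E ->
  (forall z, (K `*` K) z -> `|h i z - h j z| <= e)%R ->
  \int[P]_z (trunc i M z)%:E <= \int[P]_z (trunc j M z)%:E + (e + M * (d + d))%:E.
Proof.
move=> M0 e0 cK c muK nuK hij.
have mK := compact_borel cK.
have mKK : measurable (~` (K `*` K) : set (borelType (X * X)%type)).
  by apply: measurableC; exact: setX_borel.
apply: (@le_trans _ _ (\int[P]_z (trunc j M z)%:E + e%:E + M%:E * P (~` (K `*` K)))).
  apply: integral_le_approx => //.
  - exact: trunc_borel.
  - exact: trunc_borel.
  - by move=> z; exact: trunc_ge0.
  - by move=> z; exact: trunc_ge0.
  - by move=> z /contrapT /hij; exact: trunc_near.
  - by move=> z _; exact: trunc_le.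
rewrite -addeA leeD2l// EFinD leeD2l// EFinM lee_wpmul2l ?lee_fin//.
by rewrite EFinD (le_trans (coupling_setXC c mK mK))// leeD// ltW.
Qed.

(** The truncation level is [N + N]: if [a + b >= h > N + N], at least one of [a], [b] is at least
    [N], and a summand below [N] is absorbed by the level. Hence the excess of [h] is at most the
    sum of the tails of [a] and [b], whose integrals depend on the marginals only. *)
Lemma unif_integrable_tail (e : R) : (0 < e)%R -> exists M : R, (0 < M)%R /\
  forall n (P : probability (borelType (X * X)%type) R), (0 < n)%N ->
  coupling (mu n) (nu n) P ->
  \int[P]_z (h n z)%:E <= \int[P]_z (trunc n M z)%:E + e%:E.
Proof.
move=> e0.
have e_nbhs : nbhs (0 : \bar R) [set x | x < e%:E].
  by apply: open_nbhs_nbhs; split; [exact: open_ereal_lt_ereal|rewrite /= lte_fin].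
have [N [tailN N0]] := filter_ex
  (@filterI _ (pinfty_nbhs R) _ _ _ (ab_unif_integrable e_nbhs)
    (nbhs_pinfty_gt (num_real 0%R))).
exists (N + N)%R; split; first by rewrite addr_gt0.
move=> n P n0 c.
pose A := [set x | (N <= a n x)%R]; pose B := [set x | (N <= b n x)%R].
have ma : measurable_fun [set: borelType X] (a n : borelType X -> R).
  by apply/measurable_EFinP; exact: measurable_int (a_integrable n0).
have mb : measurable_fun [set: borelType X] (b n : borelType X -> R).
  by apply/measurable_EFinP; exact: measurable_int (b_integrable n0).
have mge (f : X -> R) : measurable_fun [set: borelType X] (f : borelType X -> R) ->
    measurable ([set x | (N <= f x)%R] : set (borelType X)).
  move=> mf; rewrite (_ : [set x | _] = f @^-1` `[N, +oo[%classic).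
    by rewrite -[X in measurable X]setTI; exact: mf.
  by apply/seteqP; split => x /=; rewrite in_itv/= andbT.
have restr (Q : probability (borelType X) R) (f : X -> R) (D : set X) :
    \int[Q]_(x in D) (f x)%:E = \int[Q]_x (f x * \1_D x)%:E.
  rewrite integral_mkcond; apply: eq_integral => x _; rewrite /patch indicE.
  by case: (x \in D); rewrite ?mulr1 ?mulr0.
have mA1 : measurable_fun [set: borelType X] (fun x : borelType X => (a n x * \1_A x)%:E).
  apply/measurable_EFinP; apply: measurable_funM => //.
  by apply: measurable_indic; exact: mge.
have mB1 : measurable_fun [set: borelType X] (fun x : borelType X => (b n x * \1_B x)%:E).
  apply/measurable_EFinP; apply: measurable_funM => //.
  by apply: measurable_indic; exact: mge.
have A0 x : 0 <= (a n x * \1_A x)%:E by rewrite lee_fin mulr_ge0// a_ge0.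
have B0 x : 0 <= (b n x * \1_B x)%:E by rewrite lee_fin mulr_ge0// b_ge0.
have AB : \int[P]_z (a n z.1 * \1_A z.1)%:E + \int[P]_z (b n z.2 * \1_B z.2)%:E <= e%:E.
  rewrite (coupling_integral_fst c mA1)// (coupling_integral_snd c mB1)//.
  rewrite -!restr; apply: (le_trans _ (ltW tailN)).
  by apply: ereal_sup_ubound; exists n.
apply: (le_trans _ (leeD2l _ AB)).
have mt := trunc_borel n (N + N).
have t0 z : (0 <= trunc n (N + N) z)%R by apply: trunc_ge0; rewrite ltW// addr_gt0.
have mA2 : measurable_fun [set: borelType (X * X)%type]
    (fun z : borelType (X * X)%type => (a n z.1 * \1_A z.1)%:E).
  by apply: (measurableT_comp mA1); exact: fst_borel.
have mB2 : measurable_fun [set: borelType (X * X)%type]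
    (fun z : borelType (X * X)%type => (b n z.2 * \1_B z.2)%:E).
  by apply: (measurableT_comp mB1); exact: snd_borel.
rewrite -ge0_integralD// -ge0_integralD//; last 4 first.
- by move=> z _; rewrite lee_fin.
- exact/measurable_EFinP.
- by move=> z _; rewrite adde_ge0.
- exact: emeasurable_funD.
apply: ge0_le_integral => //.
- by move=> z _; rewrite lee_fin.
- by apply/measurable_EFinP; exact: h_borel.
- by apply: emeasurable_funD; [exact/measurable_EFinP|exact: emeasurable_funD].
- move=> [x y] _; rewrite -!EFinD lee_fin /trunc /=.
  have := h_le x y n0; have := a_ge0 x n0; have := b_ge0 y n0.
  rewrite !indicE; have [_|NN] := leP (h n (x, y)) (N + N)%R.
    by move=> b0 a0 _; rewrite lerDl addr_ge0// mulr_ge0.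
  case: (boolP (x \in A)) => [/set_mem|]; case: (boolP (y \in B)) => [/set_mem|];
    rewrite ?notin_setE /A /B /= ?mulr1 ?mulr0 ?addr0 ?add0r => yB xA; move: yB xA NN N0;
    rewrite -?ltNge => *; lra.
Qed.

Lemma trunc_le_cost n (P : probability (borelType (X * X)%type) R) (M : R) :
  (0 <= M)%R -> \int[P]_z (trunc n M z)%:E <= \int[P]_z (h n z)%:E.
Proof.
move=> M0; apply: ge0_le_integral => //.
- by move=> z _; rewrite lee_fin trunc_ge0.
- by apply/measurable_EFinP; exact: trunc_borel.
- by apply/measurable_EFinP; exact: h_borel.
- by move=> z _; rewrite lee_fin /trunc ge_min lexx.
Qed.

(* [h 0] need not be continuous on all of [X * X]; its truncation is replaced by
   that of the continuous [h m], with [m] fixed, which is close to it on a compact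
   set carrying most of the mass of every plan. *)
Lemma compact_approximation (M e : R) : (0 < M)%R -> (0 < e)%R ->
  exists m, (0 < m)%N /\
  (forall P, coupling (mu 0%N) (nu 0%N) P ->
    \int[P]_z (trunc 0 M z)%:E <= \int[P]_z (trunc m M z)%:E + (2 * e)%:E /\
    \int[P]_z (trunc m M z)%:E <= \int[P]_z (trunc 0 M z)%:E + (2 * e)%:E) /\
  \forall n \near \oo, forall P, coupling (mu n) (nu n) P ->
    \int[P]_z (trunc n M z)%:E <= \int[P]_z (trunc m M z)%:E + (3 * e)%:E /\
    \int[P]_z (trunc m M z)%:E <= \int[P]_z (trunc n M z)%:E + (3 * e)%:E.
Proof.
move=> M0 e0.
(* The mass [d + d] outside [K * K] then costs [M * (d + d) = e]. On [K * K] the error is [e]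
   against [h 0], and [e + e] between [h n] and [h m], compared through [h 0]. *)
pose d : R := (e / (2 * M))%R.
have d0 : (0 < d)%R by rewrite divr_gt0// mulr_gt0.
have Md : (M * (d + d) = e)%R by rewrite /d; field; rewrite gt_eqF.
have [K [cK Kd]] := tight_compact d0.
have cKK : compact (K `*` K) by exact: compact_setX.
have hK := h_cvg_compact cKK e0.
have [m [hm m0]] := filter_ex (filterI hK (nbhs_infty_gt 0%N)).
have e_ge0 := ltW e0; have M_ge0 := ltW M0.
exists m; split => //; split.
  move=> P cP; have [muK nuK] := Kd 0%N.
  have -> : (2 * e = e + M * (d + d))%R by rewrite Md mulr2n mulrDl mul1r.
  split; apply: (integral_trunc_near _ _ cK cP) => // z Kz; first exact/ltW/hm.
  by rewrite distrC; exact/ltW/hm.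
apply: filterS hK => n hn P cP; have [muK nuK] := Kd n.
have -> : (3 * e = (e + e) + M * (d + d))%R by rewrite Md; ring.
have hnm z : (K `*` K) z -> (`|h n z - h m z| <= e + e)%R.
  move=> Kz; rewrite -(subrKA (h 0%N z)) (le_trans (ler_normD _ _))// lerD//.
    by rewrite distrC; exact/ltW/hn.
  exact/ltW/hm.
split; apply: (integral_trunc_near _ _ cK cP) => //; rewrite ?addr_ge0//.
by move=> z Kz; rewrite distrC; exact: hnm.
Qed.

Lemma cost_limsup (T : X -> X) (e : R) :
  transport_map (mu 0%N) (nu 0%N) T -> generated_by (mu 0%N) T (sigma 0%N) ->
  (0 < e)%R -> \forall n \near \oo,
  kantorovich_cost (mu n) (nu n) (h n) <= \int[sigma 0%N]_z (h 0%N z)%:E + e%:E.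
Proof.
move=> T_transport sigma_T e0.
(* One part for the tail, three and two for the two comparisons with [h m], one for the
   competitor. *)
have e'0 : (0 < e / 7)%R by rewrite divr_gt0.
set e' : R := (e / 7)%R in e'0.
have [M [M0 tailM]] := unif_integrable_tail e'0.
have M_ge0 := ltW M0.
have [m [m0 [m_0 m_near]]] := compact_approximation M0 e'0.
have := @plan_approximation R X mu nu (sigma 0%N) T nu_radon mu_cvg nu_cvg tight_compact
  (sigma_coupling 0%N) T_transport sigma_T (trunc m M) M (trunc_continuous (M := M) m0)
  (fun z => introT andP (conj (trunc_ge0 m z M_ge0) (trunc_le m M z))) e' e'0.
move=> plan; apply: filterS (filterI (filterI plan m_near) (nbhs_infty_gt 0%N)).
move=> n [[[pi [cpi piP]] near_n] n0].
apply: (@le_trans _ _ (\int[pi]_z (h n z)%:E)).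
  by apply: ereal_inf_lbound; exists pi.
have h1 := tailM n pi n0 cpi.
have [h2 _] := near_n pi cpi.
have [_ h3] := m_0 _ (sigma_coupling 0%N).
have h4 := trunc_le_cost 0 (sigma 0%N) M_ge0.
move: h1 h2 piP h3 h4.
move: (\int[pi]_z (h n z)%:E) (\int[pi]_z (trunc n M z)%:E)
  (\int[pi]_z (trunc m M z)%:E) (\int[sigma 0%N]_z (trunc m M z)%:E)
  (\int[sigma 0%N]_z (trunc 0 M z)%:E) (\int[sigma 0%N]_z (h 0%N z)%:E).
move=> i1 i2 i3 i4 i5 i6 h1 h2 h3 h4 h5.
apply: (le_trans h1); apply: (le_trans (leeD2r _ h2)).
apply: (le_trans (leeD2r _ (leeD2r _ h3))).
apply: (le_trans (leeD2r _ (leeD2r _ (leeD2r _ h4)))).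
apply: (le_trans (leeD2r _ (leeD2r _ (leeD2r _ (leeD2r _ h5))))).
rewrite -!addeA -!EFinD leeD2l// lee_fin le_eqVlt; apply/orP; left; apply/eqP.
by rewrite /e'; field.
Qed.

Section ultralimit_plan.
Variables (U : set_system nat) (Q : probability (borelType (X * X)%type) R).
Hypotheses (PU : ProperFilter U) (ooU : \oo `<=` U)
  (QF : forall F : set (X * X)%type, closed F -> forall e : R, (0 < e)%R ->
    \forall n \near U, sigma n F <= Q F + e%:E).

Lemma open_near (G : set (X * X)%type) (e : R) : open G -> (0 < e)%R ->
  \forall n \near U, Q G <= sigma n G + e%:E.
Proof.
move=> oG e0; have cG := open_closedC oG.
apply: filterS (QF cG e0) => n; have mG := open_borel oG.
rewrite [sigma n _]probability_setC// [Q _]probability_setC//.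
have [r ->] := probability_EFin (sigma n) mG; have [q ->] := probability_EFin Q mG.
by rewrite -!EFinB -!EFinD !lee_fin; lra.
Qed.

(** For the continuous [trunc m M] the superlevel sets are open, so the bound of [open_near] passes
    to integrals through [integral_le_near]. The error is divided into 2 + 1 + 3 parts. *)
Lemma cost_liminf (M e : R) : (0 < M)%R -> (0 < e)%R ->
  \forall n \near U, \int[Q]_z (trunc 0 M z)%:E <= \int[sigma n]_z (h n z)%:E + e%:E.
Proof.
move=> M0 e0.
have e'0 : (0 < e / 6)%R by rewrite divr_gt0.
set e' : R := (e / 6)%R in e'0.
have M_ge0 := ltW M0.
have [m [m0 [m_0 m_near]]] := compact_approximation M0 e'0.
have cQ := coupling_ultralimit PU ooU mu_cvg nu_cvg sigma_coupling QF.
have weak : \forall n \near U, \int[Q]_z (trunc m M z)%:E <=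
    \int[sigma n]_z (trunc m M z)%:E + e'%:E.
  apply: (@integral_le_near _ _ R U _ (fun=> Q) sigma _ M) => //.
  - exact: trunc_borel.
  - by move=> z; rewrite trunc_ge0//= trunc_le.
  - move=> t d d0; apply: open_near => //.
    apply: (@open_comp _ _ (trunc m M) [set x | (t < x)%R]); last exact: open_gt.
    by move=> z _; exact: trunc_continuous.
apply: filterS (filterI weak (ooU m_near)) => n [h2 /(_ _ (sigma_coupling n))[_ h3]].
have [h1 _] := m_0 _ cQ.
have h4 := trunc_le_cost n (sigma n) M_ge0.
move: h1 h2 h3 h4.
move: (\int[Q]_z (trunc 0 M z)%:E) (\int[Q]_z (trunc m M z)%:E)
  (\int[sigma n]_z (trunc m M z)%:E) (\int[sigma n]_z (trunc n M z)%:E)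
  (\int[sigma n]_z (h n z)%:E).
move=> i1 i2 i3 i4 i5 h1 h2 h3 h4.
apply: (le_trans h1); apply: (le_trans (leeD2r _ h2)).
apply: (le_trans (leeD2r _ (leeD2r _ h3))).
apply: (le_trans (leeD2r _ (leeD2r _ (leeD2r _ h4)))).
rewrite -!addeA -!EFinD leeD2l// lee_fin le_eqVlt; apply/orP; left; apply/eqP.
by rewrite /e'; field.
Qed.

(** At a single index [k], the optimal cost is nearly above the truncated cost of [Q] and nearly
    below the cost of [sigma 0]. Monotone convergence then removes the truncation. *)
Lemma ultralimit_cost_le (T : X -> X) :
  transport_map (mu 0%N) (nu 0%N) T -> generated_by (mu 0%N) T (sigma 0%N) ->
  (forall n, optimal_plan (mu n) (nu n) (h n) (sigma n)) ->
  \int[Q]_z (h 0%N z)%:E <= \int[sigma 0%N]_z (h 0%N z)%:E.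
Proof.
move=> T_transport sigma_T opt.
have trunc_lim : \int[Q]_z (trunc 0 n.+1%:R z)%:E @[n --> \oo] --> \int[Q]_z (h 0%N z)%:E.
  (* The sequence is constant once the level exceeds [h 0 z]. *)
  have trunc_cvg z : (trunc 0 n.+1%:R z)%:E @[n --> \oo] --> (h 0%N z)%:E.
    apply: cvg_near_cst.
    exists (Num.truncn (h 0%N z)) => // k /= hk; congr EFin; rewrite /trunc min_l//.
    by rewrite ltW// (lt_le_trans (Num.Theory.truncnS_gt _))// ler_nat ltnS.
  under [X in _ --> X]eq_integral => z _ do
    rewrite -(cvg_lim (@ereal_hausdorff R) (trunc_cvg z)).
  apply: (@cvg_monotone_convergence _ _ _ Q setT _
    (fun n (z : borelType (X * X)%type) => (trunc 0 n.+1%:R z)%:E)) => //.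
  - by move=> n; apply/measurable_EFinP; exact: trunc_borel.
  - by move=> n z _; rewrite lee_fin trunc_ge0.
  - move=> z _ i j ij; rewrite lee_fin /trunc le_min !ge_min lexx/=.
    by rewrite ler_nat ltnS ij orbT.
apply: (cvge_to_le trunc_lim); apply: nearW => n.
apply/lee_addgt0Pr => e e0.
have e20 : (0 < e / 2)%R by rewrite divr_gt0.
have [k [lo up]] := filter_ex (filterI (cost_liminf (ltr0Sn R n) e20)
  (ooU (cost_limsup T_transport sigma_T e20))).
apply: (le_trans lo); rewrite (opt k).2; apply: (le_trans (leeD2r _ up)).
by rewrite -addeA -EFinD -splitr.
Qed.

End ultralimit_plan.
End cost_stability.

(** * Convergence of the maps *)

Section convergence_in_measure.
Context {R : realType} {X : pmetricType R}.
Variables (mu nu : nat -> probability (borelType X) R)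
  (sigma : nat -> probability (borelType (X * X)%type) R) (T : nat -> X -> X)
  (U : set_system nat).
Hypotheses (FU : Filter U) (ooU : \oo `<=` U)
  (mu0_radon : radon (mu 0%N)) (nu0_radon : radon (nu 0%N))
  (mu_cvg : cvg_in_variation mu (mu 0%N))
  (T_transport : forall n, transport_map (mu n) (nu n) (T n))
  (sigma_T : forall n, generated_by (mu n) (T n) (sigma n))
  (sigma_closed : forall F : set (X * X)%type, closed F -> forall e : R, (0 < e)%R ->
    \forall n \near U, sigma n F <= sigma 0%N F + e%:E).

Lemma transport_borel n (A : set (borelType X)) : measurable A ->
  measurable (T n @^-1` A : set (borelType X)).
Proof. by move=> mA; rewrite -[X in measurable X]setTI; exact: (T_transport n).1. Qed.

Lemma plan_setX n (A B : set (borelType X)) : measurable A -> measurable B ->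
  sigma n (A `*` B) = mu n (A `&` T n @^-1` B).
Proof.
move=> mA mB; rewrite (sigma_T _ (setX_borel mA mB)).
apply: (measurable_mu_extE (mu n : {measure set (borelType X) -> \bar R})).
by apply: measurableI => //; exact: transport_borel.
Qed.

(* Inner regularity of [mu 0] replaces [A] by a compact set [C], so that [C `*` F]
   is closed and has [sigma 0]-measure zero. *)
Lemma transport_separated (A : set (borelType X)) (F : set X) (e : R) :
  measurable A -> closed F -> (forall x, A x -> ~ F (T 0%N x)) -> (0 < e)%R ->
  \forall n \near U, mu 0%N (A `&` T n @^-1` F) <= e%:E.
Proof.
move=> mA cF AF e0.
have e40 : (0 < e / 4)%R by rewrite divr_gt0.
have [C [cC CA AC]] := mu0_radon mA e40.
have clC : closed C by apply: compact_closed => //; exact: metric_hausdorff.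
have mC := compact_borel cC; have mF := closed_borel cF.
have cCF : closed (C `*` F).
  apply: (@closedI _ (fst @^-1` C) (snd @^-1` F)); apply: closed_comp => // z _.
    exact: cvg_fst.
  exact: cvg_snd.
have CF0 : sigma 0%N (C `*` F) = 0.
  rewrite plan_setX// (_ : _ `&` _ = set0) ?measure0//.
  by rewrite -subset0 => x [/CA/AF].
apply: filterS (filterI (ooU (cvg_in_variation_near mu_cvg e40)) (sigma_closed cCF e40)).
move=> n [var]; rewrite CF0 add0e plan_setX// => CFn.
have mTF := transport_borel n mF.
have mACT := measurableD mA mC.
apply: (@le_trans _ _ (mu 0%N ((A `\` C) `|` (C `&` T n @^-1` F)))).
  apply: le_measure; rewrite ?inE//; [exact: measurableI| |].
    by apply: measurableU => //; exact: measurableI.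
  by move=> x [Ax Fx]; have [Cx|nCx] := pselect (C x); [right|left].
apply: (le_trans (measureU2 _ _ _)) => //; first exact: measurableI.
have [_ v] := var _ (measurableI _ _ mC mTF).
apply: (le_trans (leeD (ltW AC) (le_trans v (leeD2r _ CFn)))).
by rewrite -!EFinD lee_fin; lra.
Qed.

Lemma transport_separated_seq (s : seq X) (A F : X -> set X) (e : R) :
  (forall y, measurable (A y : set (borelType X))) -> (forall y, closed (F y)) ->
  (forall y x, A y x -> ~ F y (T 0%N x)) -> (0 < e)%R ->
  \forall n \near U,
    mu 0%N (\big[setU/set0]_(y <- s) (A y `&` T n @^-1` (F y))) <= e%:E.
Proof.
move=> mA cF AF; elim: s e => [|y s IH] e e0.
  by apply: nearW => n; rewrite big_nil measure0 lee_fin ltW.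
have e20 : (0 < e / 2)%R by rewrite divr_gt0.
apply: filterS (filterI (transport_separated (mA y) (cF y) (@AF y) e20) (IH _ e20)).
move=> n [yn sn]; rewrite big_cons.
have mE z : measurable (A z `&` T n @^-1` (F z) : set (borelType X)).
  by apply: measurableI => //; apply: transport_borel; exact: closed_borel.
apply: (le_trans (measureU2 _ _ _)) => //.
  by apply: bigsetU_measurable => z _; exact: mE.
by rewrite [e in e%:E]splitr EFinD leeD.
Qed.

Lemma cvg_in_measure_near (delta e : R) : (0 < delta)%R -> (0 < e)%R ->
  \forall n \near U,
    mu_ext (mu 0%N) [set x : X | (delta <= mdist (T n x) (T 0%N x))%R] <= e%:E.
Proof.
move=> delta0 e0.
have e20 : (0 < e / 2)%R by rewrite divr_gt0.
have [L [cL _ Le]] := nu0_radon measurableT e20.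
(* If [T 0 x] is within [r] of [y] and [T n x] within [r + r], their distance is less than [delta].
   Taking interiors makes [B y] open and [F y] closed. *)
pose r : R := (delta / 3)%R.
have r0 : (0 < r)%R by rewrite divr_gt0.
pose B (y : X) : set X := interior (ball y r).
pose F (y : X) : set X := ~` interior (ball y (r + r)).
have oB y : open (B y) by exact: open_interior.
have cF y : closed (F y) by apply: open_closedC; exact: open_interior.
have [D _ LD] : finite_subset_cover L B L.
  move: cL; rewrite compact_cover; apply => // y Ly.
  by exists y => //; apply: nbhsx_ballx.
pose A y : set X := T 0%N @^-1` (B y).
have mA y : measurable (A y : set (borelType X)).
  by apply: transport_borel; exact: open_borel.
have AF y x : A y x -> ~ F y (T 0%N x).
  move=> Bx; apply; move: Bx; apply: interiorS; apply: le_ball.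
  by rewrite lerDl ltW.
have mL : measurable (~` L : set (borelType X)) by apply: measurableC; exact: compact_borel.
apply: filterS (transport_separated_seq (finmap.enum_fset D) mA cF AF e20) => n En.
have mE : measurable (\big[setU/set0]_(y <- finmap.enum_fset D)
    (A y `&` T n @^-1` (F y)) : set (borelType X)).
  apply: bigsetU_measurable => z _; apply: measurableI => //.
  by apply: transport_borel; exact: closed_borel.
have mL0 := transport_borel 0 mL.
have E : mu_ext (mu 0%N) [set x : X | (delta <= mdist (T n x) (T 0%N x))%R] <=
    mu_ext (mu 0%N) (T 0%N @^-1` (~` L) `|`
      \big[setU/set0]_(y <- finmap.enum_fset D) (A y `&` T n @^-1` (F y))).
  apply: le_mu_ext => x /= dx; have [Lx|nLx] := pselect (L (T 0%N x)); last by left.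
  right; have [y /= yD By] := LD _ Lx; rewrite -bigcup_seq; exists y => //; split=> //.
  move=> /interior_subset; have := interior_subset By; rewrite !ballEmdist/= => d1 d2.
  have := metric_triangle (T n x) y (T 0%N x); rewrite (metric_sym (T n x) y).
  by move: dx d1 d2; rewrite /r; lra.
apply: (le_trans E).
rewrite (measurable_mu_extE (mu 0%N : {measure set (borelType X) -> \bar R})); last first.
  exact: measurableU.
apply: (le_trans (measureU2 _ _ _)) => //.
rewrite [e in e%:E]splitr EFinD leeD//.
have [_ /(_ _ mL) TL] := T_transport 0%N.
by rewrite [X in X <= _]TL; rewrite -setTD ltW.
Qed.

End convergence_in_measure.

(** If [S] were not in [F], the restriction of [F] to the complement of [S] would be proper, and an
    ultrafilter extending it would contain both [S] and its complement. *)
Lemma ultrafilter_near (F : set_system nat) (S : set nat) : Filter F ->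
  (forall U, UltraFilter U -> F `<=` U -> U S) -> F S.
Proof.
move=> FF US; apply: contrapT => nFS.
have PW : ProperFilter (within (~` S) F).
  apply: Build_ProperFilter_ex => A WA; apply: contrapT => nA; apply: nFS.
  apply: (@filterS _ F _ _ _ _ WA) => n An.
  by apply: contrapT => /An An'; apply: nA; exists n.
have [U [UU WU]] := ultraFilterLemma PW.
have FU : F `<=` U.
  by move=> A FA; apply: WU; apply: (@filterS _ F _ _ _ _ FA) => n An _.
have USc : U (~` S) by apply: WU; exact: (@filterS _ F _ setT _ _ filterT).
by have [n [/= + nS]] := filter_ex (filterI USc (US _ UU FU)); exact.
Qed.

Lemma cvge0_near (R : realType) (F : set_system nat) (v : nat -> \bar R) : Filter F ->
  (forall n, 0 <= v n) -> (forall e : R, (0 < e)%R -> \forall n \near F, v n <= e%:E) ->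
  v @ F --> 0.
Proof.
move=> FF v0 ve A [e /= e0 eA].
have e20 : (0 < e / 2)%R by rewrite divr_gt0.
apply: filterS (ve _ e20) => n /=; have := v0 n; case: (v n) => [r| |]//=.
rewrite !lee_fin => r0 re; apply: eA => /=; rewrite sub0r normrN ger0_norm//.
by rewrite (le_lt_trans re)// ltr_pdivrMr// ltr_pMr// ltr1n.
Qed.

Theorem corollary3p10 (R : realType) (X : pmetricType R)
    (mu nu : nat -> probability (borelType X) R)
    (h : nat -> X * X -> R) (a b : nat -> X -> R)
    (sigma : nat -> probability (borelType (X * X)%type) R)
    (T : nat -> X -> X)
    (mu_radon : forall n, radon (mu n))
    (nu_radon : forall n, radon (nu n))
    (mu_cvg : cvg_in_variation mu (mu 0%N))
    (nu_cvg : cvg_weakly nu (nu 0%N))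
    (mu_tight : uniformly_tight [set mu n | n in [set n | (0 < n)%N]])
    (nu_tight : uniformly_tight [set nu n | n in [set n | (0 < n)%N]])
    (h_ge0 : forall n z, (0 <= h n z)%R)
    (h_continuous : forall n, (0 < n)%N -> continuous (h n))
    (h_cvg : {family compact, h @ \oo --> h 0%N})
    (a_ge0 : forall n x, (0 < n)%N -> (0 <= a n x)%R)
    (b_ge0 : forall n x, (0 < n)%N -> (0 <= b n x)%R)
    (a_integrable : forall n, (0 < n)%N ->
      (mu n).-integrable [set: borelType X] (fun x => (a n x)%:E))
    (b_integrable : forall n, (0 < n)%N ->
      (nu n).-integrable [set: borelType X] (fun x => (b n x)%:E))
    (h_le : forall n x y, (0 < n)%N -> (h n (x, y) <= a n x + b n y)%R)
    (ab_unif_integrable :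
      ereal_sup [set \int[mu n]_(x in [set x | (a n x >= M)%R]) (a n x)%:E
                     + \int[nu n]_(x in [set x | (b n x >= M)%R]) (b n x)%:E
                | n in [set n | (0 < n)%N]] @[M --> +oo%R] --> 0)
    (sigma_optimal : forall n,
      unique_optimal_plan (mu n) (nu n) (h n) (sigma n))
    (T_optimal : forall n,
      unique_monge_optimal (mu n) (nu n) (h n) (T n))
    (sigma_T : forall n, generated_by (mu n) (T n) (sigma n)) :
  cvg_in_measure (mu 0%N) T (T 0%N).

Proof.
have sigma_coupling n : coupling (mu n) (nu n) (sigma n) by have [[]] := sigma_optimal n.
have opt n : optimal_plan (mu n) (nu n) (h n) (sigma n) by have [] := sigma_optimal n.
have T_transport n : transport_map (mu n) (nu n) (T n) by have [[]] := T_optimal n.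
move=> delta delta0; apply: cvge0_near => [n|e e0]; first exact: mu_ext_ge0.
apply: ultrafilter_near => U UU ooU.
have tight (d : R) : (0 < d)%R -> exists K : set (X * X)%type, compact K /\
    forall n (G : set (X * X)%type), open G -> K `<=` G -> (1 - d)%:E <= sigma n G.
  move=> d0; have d20 : (0 < d / 2)%R by rewrite divr_gt0.
  have [K [cK Kd]] := tight_compact mu_radon nu_radon mu_tight nu_tight d20.
  exists (K `*` K); split; first exact: compact_setX.
  move=> n G oG KG; have mK := compact_borel cK; have mKK := setX_borel mK mK.
  have mKKC := measurableC mKK.
  apply: (@le_trans _ _ (sigma n (K `*` K))); last first.
    by apply: le_measure; rewrite ?inE//; exact: open_borel.
  have [muK nuK] := Kd n.
  have : sigma n (~` (K `*` K)) <= d%:E.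
    apply: (le_trans (coupling_setXC (sigma_coupling n) mK mK)).
    by rewrite [d in d%:E]splitr EFinD leeD// ltW.
  rewrite [X in X <= _ -> _]probability_setC//.
  have [q ->] := probability_EFin (sigma n) mKK.
  by rewrite -EFinB !lee_fin; lra.
have [Q QF] := tight_ultralimit UU tight.
have Q_coupling : coupling (mu 0%N) (nu 0%N) Q.
  exact: coupling_ultralimit ooU mu_cvg nu_cvg sigma_coupling QF.
have Q_optimal : optimal_plan (mu 0%N) (nu 0%N) (h 0%N) Q.
  split=> //; apply/eqP; rewrite eq_le; apply/andP; split; last first.
    by apply: ereal_inf_lbound; exists Q.
  rewrite -(opt 0%N).2.
  apply: (ultralimit_cost_le mu_radon nu_radon mu_cvg nu_cvg mu_tight nu_tight h_ge0
    h_continuous h_cvg a_ge0 b_ge0 a_integrable b_integrable h_le ab_unif_integrable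
    sigma_coupling _ ooU QF (T_transport 0%N) (sigma_T 0%N) opt).
have Qsigma B : measurable (B : set (borelType (X * X)%type)) -> Q B = sigma 0%N B.
  by have [_] := sigma_optimal 0%N; apply.
(* This is the bound of [QF] with [sigma 0] in place of [Q]: all that the convergence of the maps
   retains of optimality. *)
have sigma_closed (F : set (X * X)%type) : closed F -> forall d : R, (0 < d)%R ->
    \forall n \near U, sigma n F <= sigma 0%N F + d%:E.
  by move=> cF d d0; rewrite -Qsigma; [exact: QF|exact: closed_borel].
exact: (cvg_in_measure_near _ ooU (mu_radon 0%N) (nu_radon 0%N) mu_cvg T_transport sigma_T
  sigma_closed delta0 e0).
Qed.
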